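(* There are whole plane tilings by the Spectre, without reflections; that is, the plane can be covered by images of the Spectre under orientation-preserving isometries, with pairwise disjoint interiors.
   Context: The Spectre is the closed polygon with successive vertices $P_0=(0,0),P_1,\dots,P_{13}$ obtained by 14 unit steps starting at $P_0$ in the directions (in degrees) $0,60,330,270,0,300,210,150,240,180,180,120,30,90$ (so the angle at $P_{10}$ is flat and the last step returns to $P_0$). *)

(* Defs.v *)
From HB Require Import structures.
From mathcomp Require Import all_boot all_order all_algebra.
From mathcomp Require Import all_classical all_reals all_analysis.
Set Implicit Arguments.
Unset Strict Implicit.
Unset Printing Implicit Defensive.
Import Order.TTheory GRing.Theory Num.Theory.
Import numFieldNormedType.Exports.
Local Open Scope classical_set_scope.
Local Open Scope ring_scope.

(* The library norm on [R * R] is the sup norm: it is used below only through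
   the topology and the bounded sets, which are the Euclidean ones. Distances
   are measured with [edist2]. *)
Definition edist2 (R : realType) (p q : R * R) : R :=
  Num.sqrt ((p.1 - q.1) ^+ 2 + (p.2 - q.2) ^+ 2).

(* Twice the signed area of the triangle [p q r]; positive exactly when
   [p, q, r] are in counterclockwise order. *)
Definition signed_area2 (R : realType) (p q r : R * R) : R :=
  (q.1 - p.1) * (r.2 - p.2) - (q.2 - p.2) * (r.1 - p.1).

Definition euclidean_isometry (R : realType) (f : R * R -> R * R) : Prop :=
  forall p q, edist2 (f p) (f q) = edist2 p q.

Definition orientation_preserving (R : realType) (f : R * R -> R * R) : Prop :=
  forall p q r,
    0 < signed_area2 p q r -> 0 < signed_area2 (f p) (f q) (f r).

Definition line_segment (R : realType) (p q : R * R) : set (R * R) :=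
  [set (1 - t) *: p + t *: q | t in `[0, 1]].

(* The index modulo [size s] joins the last vertex to the first one. *)
Definition polygon_boundary (R : realType) (s : seq (R * R)) : set (R * R) :=
  \bigcup_(k in `I_(size s)) line_segment s`_k s`_(k.+1 %% size s).

(* The boundary together with the bounded components of its complement, that
   is, with the interior given by the Jordan curve theorem when the boundary
   is a simple closed curve. *)
Definition closed_polygon (R : realType) (s : seq (R * R)) : set (R * R) :=
  let B := polygon_boundary s in
  B `|` [set x | ~ B x /\ bounded_set (connected_component (~` B) x)].

Definition unit_step (R : realType) (d : nat) : R * R :=
  (cos (d%:R * pi / 180), sin (d%:R * pi / 180)).

Definition spectre_directions : seq nat :=
  [:: 0; 60; 330; 270; 0; 300; 210; 150; 240; 180; 180; 120; 30; 90]%N.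

Definition spectre_vertex (R : realType) (k : nat) : R * R :=
  \sum_(d <- take k spectre_directions) unit_step R d.

Definition spectre (R : realType) : set (R * R) :=
  closed_polygon (mkseq (spectre_vertex R) 14).
Arguments spectre : clear implicits.

(* A tiling is given by its set [T] of tiles; the isometry moving [S] onto a tile
   is not part of the data. *)
Definition tiling_without_reflections (R : realType) (S : set (R * R))
    (T : set (set (R * R))) : Prop :=
  [/\ forall t, T t -> exists f : R * R -> R * R,
        [/\ euclidean_isometry f, orientation_preserving f & t = f @` S],
      cover T id = setT
    & trivIset T (@interior (R * R)%type)].

(* Main.v *)
(* Nine labelled hexagons have outlines made of eight kinds of arcs. A substitution
   replaces each arc by a word of reflected arcs in such a way that, in the free
   group, the outline of a hexagon is a product of conjugates of the outlines of
   seven or eight hexagons; at level 0 the arcs become unit steps and the hexagons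
   one or two Spectres. That the resulting clusters are discs is never needed: for
   a point x, the crossing numbers of the tiles with a half-line issued from x add
   up to the crossing number of the outline of the cluster, because both sides are
   homomorphisms on closed words. Every Theta cluster sits inside the one two levels
   higher, and the outlines move off to infinity in three half-planes, so that they
   end up winding once, clockwise, around any given x. As the Spectre is a union of
   twelve clockwise triangles, its winding number is nowhere positive, and negative
   at generic points of the tile. Around a generic x these numbers add up to -1:
   hence x lies in one tile and in no other. *)
From Stdlib Require Import BinInt.
Require Import Defs.
From mathcomp Require Import all_boot all_order all_algebra.
From mathcomp Require Import all_classical all_reals all_analysis.
From mathcomp Require Import ssrZ zify ring lra.
Set Implicit Arguments.
Unset Strict Implicit.
Unset Printing Implicit Defensive.
Import Order.TTheory GRing.Theory Num.Theory.
Import numFieldNormedType.Exports.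
Local Open Scope classical_set_scope.
Local Open Scope ring_scope.
Delimit Scope Z_scope with BZ.

(** * Words, free reduction and the substitution *)

(** The tile is defined through components of the complement of its boundary, while only crossing
    numbers can be computed. Two implications link them: a nonzero winding number keeps a component
    bounded, and a point outside the twelve triangles can flee to infinity along a ray, hence is not
    in the tile. Levels are taken two at a time: one substitution reverses orientation, two restore
    the rotation of the [Theta] cluster found inside a [Gamma] inside a [Theta]. On arc
    displacements, written exactly in the ring generated by exp (i pi / 6), two substitutions act
    through the matrix with rows (7, 1) and (6, 1), of eigenvalues 4 + sqrt 15 and 4 - sqrt 15,
    besides a fixed part. The outlines are known only recursively, so they are located on a coarse
    scale: the 90 vertices of a twice substituted [Theta] outline have height at least 40 K above
    the origin, each in its half-plane, and the arc that follows a vertex descends by at most 35 K +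
    1000, where K = 8 l + 7 m grows like the powers of 4 + sqrt 15. The finite checks are in
    integers, with 71/41 and 26/15 framing sqrt 3. *)

Section FreeReduction.
Variables (L : eqType) (linv : L -> L).

Definition winv (w : seq L) := rev (map linv w).

Definition cons_reduce (x : L) (w : seq L) : seq L :=
  if w is y :: w' then if y == linv x then w' else x :: w else [:: x].

Definition reduce (w : seq L) := foldr cons_reduce [::] w.

Lemma winv_cat v w : winv (v ++ w) = winv w ++ winv v.
Proof. by rewrite /winv map_cat rev_cat. Qed.

Lemma winv_cons x w : winv (x :: w) = winv w ++ [:: linv x].
Proof. by rewrite -cat1s winv_cat. Qed.

Section Functional.
Variables (V : zmodType) (A : zmodType) (D : L -> V) (F : V -> L -> A).

Definition wdisp (w : seq L) : V := foldr (fun x v => D x + v) 0 w.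

(** The sum of a cochain along a path: [F p x] is the contribution of the step [x] taken from the
    position [p]. *)
Fixpoint wsum (p : V) (w : seq L) : A :=
  if w is x :: w' then F p x + wsum (p + D x) w' else 0.

Lemma wdisp_cat v w : wdisp (v ++ w) = wdisp v + wdisp w.
Proof. by elim: v => [|x v IH] /=; rewrite ?add0r // IH addrA. Qed.

Lemma wsum_cat p v w : wsum p (v ++ w) = wsum p v + wsum (p + wdisp v) w.
Proof.
elim: v p => [|x v IH] p /=; first by rewrite add0r addr0.
by rewrite IH !addrA.
Qed.

Hypothesis D_inv : forall x, D (linv x) = - D x.
Hypothesis F_inv : forall p x, F (p + D x) (linv x) = - F p x.

Lemma wdisp_inv w : wdisp (winv w) = - wdisp w.
Proof.
elim: w => [|x w IH]; first by rewrite oppr0.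
by rewrite winv_cons wdisp_cat IH /= addr0 D_inv -opprD addrC.
Qed.

Lemma wsum_inv p w : wsum (p + wdisp w) (winv w) = - wsum p w.
Proof.
elim: w p => [|x w IH] p; first by rewrite oppr0.
have -> : p + wdisp (x :: w) = p + D x + wdisp w by rewrite /= addrA.
by rewrite winv_cons wsum_cat IH wdisp_inv addrK /= addr0 F_inv -opprD addrC.
Qed.

(** The way out along [u] and the way back cancel, so a conjugated closed word counts as the word
    itself, based at the end of [u]. *)
Lemma wsum_conj p u h : wdisp h = 0 ->
  wsum p (u ++ h ++ winv u) = wsum (p + wdisp u) h.
Proof.
by move=> h0; rewrite !wsum_cat h0 addr0 wsum_inv addrC subrK.
Qed.

Lemma wdisp_conj u h : wdisp h = 0 -> wdisp (u ++ h ++ winv u) = 0.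
Proof. by move=> h0; rewrite !wdisp_cat h0 wdisp_inv add0r addrN. Qed.

Lemma wdisp_reduce w : wdisp (reduce w) = wdisp w.
Proof.
elim: w => //= x w <-; case: (reduce w) => [|y w'] //=.
by case: eqP => [->|_] //=; rewrite D_inv addNKr.
Qed.

Lemma wsum_reduce p w : wsum p (reduce w) = wsum p w.
Proof.
elim: w p => //= x w IH p; rewrite -IH; case: (reduce w) => [|y w'] //=.
case: eqP => [->|_] //=.
by rewrite F_inv D_inv addrK addNKr.
Qed.

End Functional.
End FreeReduction.

Lemma forall_Z12 (P : pred 'Z_12) :
  all (fun i => P (inZp i)) (iota 0 12) -> forall k, P k.
Proof.
move=> /allP P12 k; rewrite -[k]valZpK; apply: P12.
by rewrite mem_iota /= ltn_ord.
Qed.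

(* A letter [(a, b, k)] is an arc of type [a], rotated by [k * 30] degrees and
   traversed backwards when [b] is [false]. *)
Definition letter := (nat * bool * 'Z_12)%type.
Definition word := seq letter.

(* Arcs of type 7 are invariant under a half-turn. *)
Definition linv (x : letter) : letter :=
  let: (a, b, k) := x in if a == 7%N then (a, b, k + 6%:R) else (a, ~~ b, k).

Definition lrot (j : 'Z_12) (x : letter) : letter :=
  let: (a, b, k) := x in (a, b, k + j).

Definition oriented (s : seq (nat * bool * nat)) : word :=
  [seq (x.1, inZp x.2) | x <- s].

Local Notation fw := true.
Local Notation bw := false.

Definition arc_rule (a : nat) : word :=
  oriented (nth [::] [::
    [:: (6, fw, 4); (5, bw, 3); (5, fw, 7); (7, fw, 0); (2, bw, 0)];
    [:: (6, fw, 4); (2, bw, 2); (3, bw, 1); (5, fw, 9); (6, bw, 10)];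
    [:: (3, bw, 3); (5, fw, 11)];
    [:: (5, fw, 10); (7, fw, 3); (2, bw, 3)];
    [:: (3, bw, 3); (5, fw, 11); (6, bw, 0)];
    [:: (5, fw, 10); (7, fw, 3); (5, bw, 4); (5, fw, 0)];
    [:: (6, fw, 4); (5, bw, 3); (5, fw, 7); (7, fw, 0); (5, bw, 1); (5, fw, 9)];
    [:: (5, bw, 1); (5, fw, 5); (7, fw, 10); (5, bw, 11); (5, fw, 7)]] a)%N.

(** Rotating the rule by [- k] instead of [k] is what makes the substitution a reflection. *)
Definition subst_letter (x : letter) : word :=
  let: (a, b, k) := x in
  let w := map (lrot (- k)) (arc_rule a) in if b then w else winv linv w.

Definition subst (w : word) : word := flatten (map subst_letter w).

Inductive label := Gamma | Delta | Theta | Lambda | Xi | Pi | Sigma | Phi | Psi.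

Definition hexagon (X : label) : word := oriented
  match X with
  | Gamma  => [:: (0, fw, 2); (1, fw, 0); (2, fw, 0); (2, bw, 4); (3, bw, 3); (3, fw, 7)]
  | Delta  => [:: (3, fw, 3); (0, fw, 10); (4, bw, 4); (0, bw, 0); (2, fw, 6); (5, bw, 11)]
  | Theta  => [:: (6, bw, 8); (2, fw, 2); (7, fw, 8); (2, bw, 4); (0, bw, 0); (2, fw, 6)]
  | Lambda => [:: (3, fw, 3); (6, fw, 10); (2, bw, 4); (0, bw, 0); (2, fw, 6); (5, bw, 11)]
  | Xi     => [:: (6, bw, 8); (2, fw, 2); (7, fw, 8); (2, bw, 4); (3, bw, 3); (5, fw, 7)]
  | Pi     => [:: (3, fw, 3); (6, fw, 10); (2, bw, 4); (3, bw, 3); (5, fw, 7); (5, bw, 11)]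
  | Sigma  => [:: (3, fw, 3); (0, fw, 10); (1, bw, 2); (4, fw, 8); (2, fw, 6); (5, bw, 11)]
  | Phi    => [:: (5, fw, 3); (7, fw, 8); (2, bw, 4); (0, bw, 0); (2, fw, 6); (5, bw, 11)]
  | Psi    => [:: (5, fw, 3); (7, fw, 8); (2, bw, 4); (3, bw, 3); (5, fw, 7); (5, bw, 11)]
  end%N.

Definition children (X : label) : seq (nat * nat * label * nat) :=
  match X with
  | Gamma  => [:: (5, 8, Gamma, 3); (2, 4, Phi, 5); (13, 8, Theta, 5); (6, 0, Pi, 3);
                  (5, 10, Delta, 3); (3, 6, Sigma, 1); (0, 6, Xi, 1)]
  | Delta  => [:: (10, 8, Gamma, 3); (7, 4, Phi, 5); (3, 6, Pi, 4); (2, 6, Sigma, 5);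
                  (11, 10, Xi, 5); (5, 0, Xi, 4); (3, 10, Delta, 2); (0, 8, Phi, 0)]
  | Theta  => [:: (6, 8, Gamma, 3); (3, 4, Phi, 5); (17, 8, Phi, 5); (13, 10, Pi, 4);
                  (7, 0, Psi, 3); (6, 10, Delta, 3); (4, 6, Sigma, 1); (0, 6, Pi, 5)]
  | Lambda => [:: (10, 8, Gamma, 3); (7, 4, Phi, 5); (3, 6, Pi, 4); (2, 6, Sigma, 5);
                  (11, 10, Xi, 5); (5, 0, Psi, 3); (3, 10, Delta, 2); (0, 8, Phi, 0)]
  | Xi     => [:: (6, 8, Gamma, 3); (3, 4, Phi, 5); (17, 8, Phi, 5); (13, 10, Pi, 4);
                  (7, 0, Psi, 3); (6, 10, Delta, 3); (4, 6, Sigma, 1); (0, 6, Psi, 5)]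
  | Pi     => [:: (10, 8, Gamma, 3); (7, 4, Phi, 5); (3, 6, Psi, 4); (2, 6, Sigma, 5);
                  (11, 10, Xi, 5); (5, 0, Psi, 3); (3, 10, Delta, 2); (0, 8, Phi, 0)]
  | Sigma  => [:: (10, 8, Gamma, 3); (7, 4, Lambda, 5); (3, 6, Pi, 4); (2, 6, Sigma, 5);
                  (11, 10, Xi, 5); (5, 0, Xi, 4); (3, 10, Delta, 2); (0, 8, Phi, 0)]
  | Phi    => [:: (10, 8, Gamma, 3); (7, 4, Phi, 5); (3, 6, Pi, 4); (2, 6, Sigma, 5);
                  (11, 10, Psi, 4); (5, 0, Psi, 3); (3, 10, Delta, 2); (0, 8, Phi, 0)]
  | Psi    => [:: (10, 8, Gamma, 3); (7, 4, Phi, 5); (3, 6, Psi, 4); (2, 6, Sigma, 5);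
                  (11, 10, Psi, 4); (5, 0, Psi, 3); (3, 10, Delta, 2); (0, 8, Phi, 0)]
  end%N.

Definition rhex (X : label) (k : 'Z_12) : word := map (lrot k) (hexagon X).

(* An entry [(m, k, Y, c)] glues corner [c] of the hexagon [Y], rotated by [k],
   to the [m]-th vertex of the current outline [w] and removes that hexagon
   from the region bounded by [w]; [u] leads from the base point to the
   initial corner of [Y]. *)
Fixpoint peel (j : 'Z_12) (w : word) (s : seq (nat * nat * label * nat)) :
    seq (word * label * 'Z_12) :=
  if s is (m, k, Y, c) :: s' then
    let h := rhex Y (inZp k - j) in
    let u := take m w ++ winv linv (take c h) in
    (u, Y, inZp k - j) ::
      peel j (reduce linv (winv linv (u ++ h ++ winv linv u) ++ w)) s'
  else [::].

Definition parts (X : label) (j : 'Z_12) : seq (word * label * 'Z_12) :=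
  peel j (winv linv (subst (rhex X j))) (children X).

Definition part_loop (t : word * label * 'Z_12) : word :=
  t.1.1 ++ rhex t.1.2 t.2 ++ winv linv t.1.1.

(** [peel] starts from the inverted outline, since a reflected cluster runs around its parts in the
    opposite sense; the empty result says that the children exhaust the region. *)
Lemma reduce_parts X j :
  reduce linv (flatten (map part_loop (parts X j)) ++ subst (rhex X j)) = [::].
Proof.
apply/eqP; move: j.
apply: (@forall_Z12 (fun j => reduce linv (flatten (map part_loop (parts X j))
   ++ subst (rhex X j)) == [::])).
by case: X; vm_compute.
Qed.

(** * Boundary chains of the clusters *)

Lemma winv_flatten (L M : eqType) (li : L -> L) (mi : M -> M)
    (f : L -> seq M) : (forall x, f (li x) = winv mi (f x)) ->
  forall w, flatten (map f (winv li w)) = winv mi (flatten (map f w)).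
Proof.
move=> f_inv; elim=> //= x w IH.
by rewrite winv_cons map_cat flatten_cat IH /= cats0 f_inv winv_cat.
Qed.

Lemma wdisp_flatten (L M : eqType) (V : zmodType) (D : M -> V)
    (f : L -> seq M) w :
  wdisp (fun x => wdisp D (f x)) w = wdisp D (flatten (map f w)).
Proof. by elim: w => //= x w ->; rewrite wdisp_cat. Qed.

Lemma wsum_flatten (L M : eqType) (V A : zmodType) (D : M -> V)
    (F : V -> M -> A) (f : L -> seq M) p w :
  wsum (fun x => wdisp D (f x)) (fun p x => wsum D F p (f x)) p w =
  wsum D F p (flatten (map f w)).
Proof. by elim: w p => //= x w IH p; rewrite IH wsum_cat. Qed.

(** The delicate case is type 7, whose inverse is its half-turn: the rule of that arc must itself
    become its inverse word under a half-turn. Types from 8 on have the empty rule, the default of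
    [nth]. *)
Lemma subst_letter_inv x : subst_letter (linv x) = winv linv (subst_letter x).
Proof.
case: x => [[a b] k]; apply/eqP; move: k.
apply: (@forall_Z12 (fun k => subst_letter (linv (a, b, k)) ==
                              winv linv (subst_letter (a, b, k)))).
by do 8![case: a => [|a]; first by case: b; vm_compute]; rewrite /arc_rule;
  case: b; rewrite /subst_letter /= /arc_rule /= nth_nil.
Qed.

Lemma subst_inv w : subst (winv linv w) = winv linv (subst w).
Proof. exact: (winv_flatten subst_letter_inv). Qed.

Lemma subst_cat v w : subst (v ++ w) = subst v ++ subst w.
Proof. by rewrite /subst map_cat flatten_cat. Qed.

Definition dinv (d : 'Z_12) : 'Z_12 := d + 6%:R.

Definition arc_base (a : nat) : seq 'Z_12 :=
  [seq inZp d | d <- nth [::] [:: [:: 8; 6]; [:: 11; 9; 6; 4; 7; 5];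
    [:: 5; 3; 6]; [:: 2; 5; 3]; [:: 5; 3]; [:: 2; 5]; [:: 8]; [:: 10; 10]] a]%N.

Definition ev_letter (x : letter) : seq 'Z_12 :=
  let: (a, b, k) := x in
  let w := [seq d + k | d <- arc_base a] in if b then w else winv dinv w.

Lemma ev_letter_inv x : ev_letter (linv x) = winv dinv (ev_letter x).
Proof.
case: x => [[a b] k]; apply/eqP; move: k.
apply: (@forall_Z12 (fun k => ev_letter (linv (a, b, k)) ==
                              winv dinv (ev_letter (a, b, k)))).
by do 8![case: a => [|a]; first by case: b; vm_compute];
  case: b; rewrite /ev_letter /= /arc_base /= nth_nil.
Qed.

Definition lpath (n : nat) (w : word) : seq 'Z_12 :=
  flatten (map ev_letter (iter n subst w)).

Lemma lpath_cat n v w : lpath n (v ++ w) = lpath n v ++ lpath n w.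
Proof.
rewrite /lpath; have -> : iter n subst (v ++ w) = iter n subst v ++ iter n subst w.
  by elim: n => // n IH; rewrite !iterS IH subst_cat.
by rewrite map_cat flatten_cat.
Qed.

Lemma lpath_inv n w : lpath n (winv linv w) = winv dinv (lpath n w).
Proof.
rewrite /lpath; have -> : iter n subst (winv linv w) = winv linv (iter n subst w).
  by elim: n => // n IH; rewrite !iterS IH subst_inv.
exact: (winv_flatten ev_letter_inv).
Qed.

Lemma lpathS n w : lpath n.+1 w = lpath n (subst w).
Proof. by rewrite /lpath iterSr. Qed.

Lemma lpath_nil n : lpath n [::] = [::].
Proof. by rewrite /lpath; elim: n => // n IH; rewrite iterSr. Qed.

Lemma lpath_flatten n w : lpath n w = flatten (map (fun x => lpath n [:: x]) w).
Proof.
elim: w => [|x w IH]; first by rewrite lpath_nil.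
by rewrite -cat1s lpath_cat IH.
Qed.

Definition spectre_word (k : 'Z_12) : seq 'Z_12 :=
  [seq inZp d + k | d <- [:: 0; 2; 11; 9; 0; 10; 7; 5; 8; 6; 6; 4; 1; 3]%N].

(** In an entry [(k, c)], the base point of the hexagon is corner [c] of a Spectre rotated by [k];
    going back along its first [c] sides leads to its vertex 0. [Gamma] alone stands for two
    Spectres. *)
Definition base_tiles (X : label) (j : 'Z_12) : seq (seq 'Z_12 * 'Z_12) :=
  [seq (winv dinv (take t.2 (spectre_word (inZp t.1 + j))), inZp t.1 + j)
  | t <- match X with
         | Gamma => [:: (11, 2); (0, 6)]
         | Theta | Xi => [:: (0, 5)]
         | _ => [:: (0, 7)]
         end%N].

Definition base_loop (t : seq 'Z_12 * 'Z_12) :=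
  t.1 ++ spectre_word t.2 ++ winv dinv t.1.

Lemma reduce_base_tiles X j :
  reduce dinv (winv dinv (lpath 0 (rhex X j)) ++
    flatten (map base_loop (base_tiles X j))) = [::].
Proof.
apply/eqP; move: j.
apply: (@forall_Z12 (fun j => reduce dinv (winv dinv (lpath 0 (rhex X j)) ++
    flatten (map base_loop (base_tiles X j))) == [::])).
by case: X; vm_compute.
Qed.

Section Chains.
Variables (V A : zmodType) (e : 'Z_12 -> V) (F : V -> 'Z_12 -> A).
Hypothesis e_inv : forall d, e (dinv d) = - e d.
Hypothesis F_inv : forall p d, F (p + e d) (dinv d) = - F p d.

Local Notation disp n w := (wdisp e (lpath n w)).
Local Notation chain n p w := (wsum e F p (lpath n w)).

Fixpoint tiles (n : nat) (X : label) (j : 'Z_12) (p : V) : seq (V * 'Z_12) :=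
  if n is n'.+1 then
    flatten [seq tiles n' t.1.2 t.2 (p + disp n' t.1.1) | t <- parts X j]
  else [seq (p + wdisp e t.1, t.2) | t <- base_tiles X j].

Lemma wdisp_spectre k : wdisp e (spectre_word k) = 0.
Proof.
(* The fourteen steps form seven pairs of opposite directions, 0 with 6 occurring twice; the
   permutation given to [ACL] puts partners side by side. *)
have h a b : inZp a + 6%:R = inZp b :> 'Z_12 -> e (inZp b + k) = - e (inZp a + k).
  by move=> <-; rewrite addrAC -e_inv.
rewrite /= (h 0 6)%N ?(h 2 8)%N ?(h 1 7)%N ?(h 4 10)%N ?(h 3 9)%N ?(h 5 11)%N;
  try by apply/val_inj.
rewrite addr0 !addrA (ACl (1*10*5*11*2*9*3*8*4*14*6*12*7*13)%AC) /=.
by rewrite !(subrr, addNr, add0r).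
Qed.

Lemma disp_reduce n w : wdisp e (lpath n w) = wdisp e (lpath n (reduce linv w)).
Proof.
rewrite !(lpath_flatten n) -!wdisp_flatten wdisp_reduce // => x.
by rewrite -[[:: linv x]]/(winv linv [:: x]) lpath_inv wdisp_inv.
Qed.

Lemma chain_reduce n p w : chain n p w = chain n p (reduce linv w).
Proof.
rewrite !(lpath_flatten n) -!wsum_flatten wsum_reduce //.
- by move=> x; rewrite -[[:: linv x]]/(winv linv [:: x]) lpath_inv wdisp_inv.
- by move=> q x; rewrite -[[:: linv x]]/(winv linv [:: x]) lpath_inv wsum_inv.
Qed.

Lemma chain_cat n p v w : chain n p (v ++ w) = chain n p v + chain n (p + disp n v) w.
Proof. by rewrite lpath_cat wsum_cat. Qed.

Lemma disp_rhex n X j : disp n (rhex X j) = 0.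
Proof.
elim: n X j => [|n IH] X j.
  have := congr1 (wdisp e) (reduce_base_tiles X j).
  rewrite wdisp_reduce // wdisp_cat wdisp_inv //.
  suff -> : wdisp e (flatten (map base_loop (base_tiles X j))) = 0.
    by rewrite addr0 => /eqP; rewrite oppr_eq0 => /eqP.
  elim: (base_tiles X j) => //= t s IHs.
  by rewrite wdisp_cat IHs wdisp_conj ?wdisp_spectre ?addr0.
have := disp_reduce n (flatten (map part_loop (parts X j)) ++ subst (rhex X j)).
rewrite reduce_parts lpath_cat wdisp_cat -lpathS.
suff -> : disp n (flatten (map part_loop (parts X j))) = 0.
  by rewrite add0r lpath_nil => ->.
elim: (parts X j) => [|t s IHs]; first by rewrite lpath_nil.
by rewrite /= lpath_cat wdisp_cat IHs !lpath_cat lpath_inv wdisp_conj ?addr0.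
Qed.

(** Free reduction does not change the sum along a word, so [reduce_parts] expresses the sum along
    an outline by those of its parts one level down. Each reflection contributes a sign. *)
Lemma chain_tiles n X j p : chain n p (rhex X j) =
  (\sum_(t <- tiles n X j p) wsum e F t.1 (spectre_word t.2)) *~ (-1) ^+ n.
Proof.
elim: n X j p => [|n IH] X j p.
  have := congr1 (wsum e F p) (reduce_base_tiles X j).
  rewrite wsum_reduce // wsum_cat wdisp_inv //.
  have -> : wsum e F p (winv dinv (lpath 0 (rhex X j))) = - chain 0 p (rhex X j).
    by rewrite -(wsum_inv e_inv F_inv) (disp_rhex 0) addr0.
  rewrite (disp_rhex 0) oppr0 addr0 => /eqP; rewrite addrC subr_eq0 => /eqP <-.
  rewrite expr0 mulr1z big_map.
  elim: (base_tiles X j) => [|t s IHs]; first by rewrite big_nil.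
  rewrite big_cons /= wsum_cat wsum_conj ?wdisp_spectre // wdisp_conj ?wdisp_spectre //.
  by rewrite addr0 IHs.
have := chain_reduce n p (flatten (map part_loop (parts X j)) ++ subst (rhex X j)).
have loop0 t : disp n (part_loop t) = 0.
  by rewrite !lpath_cat lpath_inv wdisp_conj ?disp_rhex.
have h0 s : disp n (flatten (map part_loop s)) = 0.
  elim: s => [|t s IHs]; first by rewrite lpath_nil.
  by rewrite /= lpath_cat wdisp_cat IHs loop0 addr0.
rewrite reduce_parts lpath_nil chain_cat h0 addr0 -lpathS => /eqP.
rewrite addrC addr_eq0 => /eqP ->; rewrite exprS mulN1r mulrNz; congr (- _).
rewrite big_flatten big_map.
elim: (parts X j) => [|t s IHs]; first by rewrite big_nil mul0rz lpath_nil.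
rewrite /= big_cons chain_cat loop0 addr0 IHs mulrzDl; congr (_ + _).
by rewrite !lpath_cat lpath_inv wsum_conj ?disp_rhex // IH.
Qed.

End Chains.

(** * Exact coordinates of the cluster outlines *)

(* [(a0, a1, a2, a3)] stands for [a0 + a1 z + a2 z^2 + a3 z^3], where
   [z = exp (i pi / 6)], so that [z^4 = z^2 - 1]. *)
Definition vec := (Z * Z * Z * Z)%type.

Definition zmul (v : vec) : vec :=
  let: (a0, a1, a2, a3) := v in (- a3, a0, a1 + a3, a2).

Definition zrot (d : 'Z_12) (v : vec) : vec := ssrnat.iter d zmul v.

Definition zunit (d : 'Z_12) : vec := zrot d (1, 0, 0, 0).

Definition arc_vec (t : seq vec) (x : letter) : vec :=
  let: (a, b, k) := x in
  let v := zrot k (nth 0 t a) in if b then v else - v.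

(* Coordinates of the arcs in which substituting twice fixes [vecC] and maps
   [(vecP, vecQ)] to [(7 vecP + vecQ, 6 vecP + vecQ)]. *)
Definition vecP := arc_vec
  [:: (0,-103,-117,41); (-76,-131,-103,103); (-48,23,55,23); (-55,-78,48,39);
      (-103,0,62,69); (-32,-71,71,87); (-55,-126,-110,87); (62,-64,-110,-16)]%BZ.
Definition vecQ := arc_vec
  [:: (0,-90,-102,36); (-66,-114,-90,90); (-42,20,48,20); (-48,-68,42,34);
      (-90,0,54,60); (-28,-62,62,76); (-48,-110,-96,76); (54,-56,-96,-14)]%BZ.
Definition vecC := arc_vec
  [:: (-1,1,2,1); (2,4,2,-2); (-1,-2,-1,1); (1,1,1,1);
      (1,-1,-2,-1); (0,0,0,0); (1,2,1,-1); (0,0,0,0)]%BZ.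

Definition subst2 (w : word) := subst (subst w).

Lemma forall_letter (P : pred letter) :
  all (fun a => all (fun b => all (fun k => P (a, b, inZp k)) (iota 0 12))
    [:: true; false]) (iota 0 8) ->
  forall a b k, (a < 8)%N -> P (a, b, k).
Proof.
move=> /allP P8 a b k a8.
have a_in : a \in iota 0 8 by rewrite mem_iota.
have b_in : b \in [:: true; false] by case: b.
move: k; apply: (@forall_Z12 (fun k => P (a, b, k))).
exact: (allP (P8 a a_in) b b_in).
Qed.

Lemma zrot0 k : zrot k 0 = 0.
Proof. by rewrite /zrot; elim: (nat_of_ord k) => //= n ->. Qed.

Lemma arc_vec_nil (t : seq vec) a b k : (size t <= a)%N -> arc_vec t (a, b, k) = 0.
Proof.
by move=> ta; rewrite /arc_vec nth_default // zrot0; case: b; rewrite ?oppr0.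
Qed.

Lemma subst2_nil a b k : (8 <= a)%N -> subst2 [:: (a, b, k)] = [::].
Proof.
move=> a8; have a8' : arc_rule a = [::] by rewrite /arc_rule nth_default.
by rewrite /subst2 {2}/subst /= a8'; case: b.
Qed.

Lemma vec_ev_letter x :
  wdisp zunit (ev_letter x) = vecP x *+ 7 - vecQ x *+ 8 + vecC x.
Proof.
case: x => [[a b] k]; have [a8|a8] := ltnP a 8.
  apply/eqP; move: a b k a8; apply: (@forall_letter (fun x =>
    wdisp zunit (ev_letter x) == vecP x *+ 7 - vecQ x *+ 8 + vecC x)).
  by vm_compute.
rewrite /vecP /vecQ /vecC !arc_vec_nil // /ev_letter /arc_base nth_default //.
by case: b.
Qed.

Lemma vec_subst2_letter x :
  [/\ wdisp vecP (subst2 [:: x]) = vecP x *+ 7 + vecQ x,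
      wdisp vecQ (subst2 [:: x]) = vecP x *+ 6 + vecQ x &
      wdisp vecC (subst2 [:: x]) = vecC x].
Proof.
case: x => [[a b] k]; have [a8|a8] := ltnP a 8; last first.
  by rewrite subst2_nil // /vecP /vecQ /vecC !arc_vec_nil.
suff /and3P[/eqP -> /eqP -> /eqP ->] :
  [&& wdisp vecP (subst2 [:: (a, b, k)]) == vecP (a, b, k) *+ 7 + vecQ (a, b, k),
      wdisp vecQ (subst2 [:: (a, b, k)]) == vecP (a, b, k) *+ 6 + vecQ (a, b, k) &
      wdisp vecC (subst2 [:: (a, b, k)]) == vecC (a, b, k)] by [].
move: a b k a8; apply: (@forall_letter (fun x =>
  [&& wdisp vecP (subst2 [:: x]) == vecP x *+ 7 + vecQ x,
      wdisp vecQ (subst2 [:: x]) == vecP x *+ 6 + vecQ x &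
      wdisp vecC (subst2 [:: x]) == vecC x])).
by vm_compute.
Qed.

(* A lower bound for [1230] times the first coordinate of [v], as
   [71 / 41 <= sqrt 3 <= 26 / 15]. *)
Definition zlo (v : vec) : Z :=
  let: (a0, a1, a2, _) := v in
  (615 * (2 * a0 + a2) + (if 0 <=? a1 then 1065 else 1066) * a1)%BZ.

(* The three half-planes that keep the outlines away from a given point face the
   directions 0, 120 and 240 degrees. *)
Definition dirs : seq 'Z_12 := [:: 0; 4%:R; 8%:R].

(** The step of the induction in [arc_excursion], which explains 55 and 48. Only proper prefixes
    occur, because the letter in which the path stops is left to the induction hypothesis. *)
Lemma zlo_subst2 x d i : d \in dirs -> (i < size (subst2 [:: x]))%N ->
  let v := take i (subst2 [:: x]) in
  - (1230 * (55 * 35))%BZ <= zlo (zrot (- d) (wdisp vecP v)) +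
                        Order.min 0 (zlo (zrot (- d) (wdisp vecC v))) /\
  - (1230 * (48 * 35))%BZ <= zlo (zrot (- d) (wdisp vecQ v)).
Proof.
case: x => [[a b] k]; have [a8|a8] := ltnP a 8; last by rewrite subst2_nil.
move=> d_in i_lt v; apply/andP; rewrite {}/v.
pose P x d i := let v := take i (subst2 [:: x]) in
  (- (1230 * (55 * 35))%BZ <= zlo (zrot (- d) (wdisp vecP v)) +
                        Order.min 0 (zlo (zrot (- d) (wdisp vecC v)))) &&
  (- (1230 * (48 * 35))%BZ <= zlo (zrot (- d) (wdisp vecQ v))).
have /allP/(_ d d_in)/allP : all (fun d =>
  all (P (a, b, k) d) (iota 0 (size (subst2 [:: (a, b, k)])))) dirs.
  move: a b k a8 {i_lt}; apply: (@forall_letter (fun x => all (fun d =>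
    all (P x d) (iota 0 (size (subst2 [:: x])))) dirs)).
  by vm_compute.
by apply; rewrite mem_iota.
Qed.

(** Base case of [arc_excursion]: a path made of unit steps cannot stray further than its length. *)
Lemma size_lpath4 x : (size (lpath 4 [:: x]) <= 1000)%N.
Proof.
case: x => [[a b] k]; have [a8|a8] := ltnP a 8; last first.
  have -> : lpath 4 [:: (a, b, k)] = lpath 2 (subst2 [:: (a, b, k)]) by [].
  by rewrite subst2_nil.
move: a b k a8; apply: (@forall_letter (fun x => size (lpath 4 [:: x]) <= 1000)%N).
by vm_compute.
Qed.

(** Passing to either of these two children turns a rotation [j] into [8 - j], so that two levels
    restore it: 3, 5, 3. *)
Definition Gamma_part := nth ([::], Theta, 0) (parts Theta 3%:R) 0.
Definition Theta_part := nth ([::], Gamma, 0) (parts Gamma 5%:R) 2.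

Lemma Gamma_partE : Gamma_part.1.2 = Gamma /\ Gamma_part.2 = 5%:R.
Proof. by split; [vm_compute | apply/eqP; vm_compute]. Qed.

Lemma Theta_partE : Theta_part.1.2 = Theta /\ Theta_part.2 = 3%:R.
Proof. by split; [vm_compute | apply/eqP; vm_compute]. Qed.

(** The path from the base point of a [Theta] cluster to that of the [Theta] cluster two levels
    below, written in arcs of the lower level. *)
Definition wcenter : word := subst Gamma_part.1.1 ++ Theta_part.1.1.

Lemma vecC_wcenter : wdisp vecC wcenter = 0.
Proof. by vm_compute. Qed.

Definition outline : word := subst2 (rhex Theta 3%:R).

(** One stretch of the outline for each half-plane, taken cyclically: the base vertex is inside the
    stretch of direction 4, which is therefore cut in two. *)
Definition outline_dir (i : nat) : 'Z_12 :=
  if (i < 17)%N then 4%:R else if (i < 51)%N then 0 else if (i < 73)%N then 8%:R else 4%:R.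

(** The vertices are measured from the origin, with the outline based at [center]; the factor 6
    clears the denominator of [center], and turns 40 times 8 and 40 times 7 into [48 * 40] and
    [42 * 40]. *)
Lemma outline_far i : (i < 90)%N ->
  let v := take i outline in let d := outline_dir i in
  (1230 * (48 * 40))%BZ <=
    zlo (zrot (- d) (wdisp vecP v *+ 6 - wdisp vecP wcenter *+ 6 - wdisp vecQ wcenter)) +
    Order.min 0 (zlo (zrot (- d) (wdisp vecC v *+ 6))) /\
  (1230 * (42 * 40))%BZ <= zlo (zrot (- d) (wdisp vecQ v *+ 6 - wdisp vecP wcenter *+ 6)).
Proof.
move=> i90 v d; apply/andP; rewrite {}/v {}/d.
have : i \in iota 0 90 by rewrite mem_iota.
move: i {i90}; apply/allP.
by vm_compute.
Qed.

(** * Crossing numbers *)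

Section Crossing.
Variable R : realType.
Implicit Types (p q r u x : R * R).

Definition dotp u p : R := u.1 * p.1 + u.2 * p.2.

Definition upper x p : bool := x.2 < p.2.

(* The signed number of crossings of the segment [p q] with the horizontal
   half-line issued from [x] to the right. *)
Definition crossing x p q : int :=
  [&& 0 < signed_area2 p q x, ~~ upper x p & upper x q]%:Z -
  [&& 0 < signed_area2 q p x, ~~ upper x q & upper x p]%:Z.

Lemma crossingN x p q : crossing x q p = - crossing x p q.
Proof. by rewrite /crossing opprB. Qed.

(** Inside the half-plane, the horizontal line through [x] is met only to the right of [x] if
    [0 < u.1], and never to the right otherwise. So either every change of side is counted or none
    is. *)
Lemma crossing_halfplane x u p q :
  0 < dotp u (p - x) -> 0 < dotp u (q - x) ->
  crossing x p q =
    if 0 < u.1 then (upper x q)%:Z - (upper x p)%:Z else 0.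
Proof.
move=> up uq.
have area_sgn a b : 0 < dotp u (a - x) -> 0 < dotp u (b - x) ->
    ~~ upper x a && upper x b -> (0 < signed_area2 a b x) = (0 < u.1).
  rewrite /upper -leNgt => ua ub /andP[xa xb].
  have : u.1 * signed_area2 a b x =
      (b.2 - x.2) * dotp u (a - x) + (x.2 - a.2) * dotp u (b - x).
    by rewrite /signed_area2 /dotp /=; ring.
  have h : 0 < (b.2 - x.2) * dotp u (a - x) + (x.2 - a.2) * dotp u (b - x).
    by rewrite ltr_pwDl ?mulr_gt0 ?mulr_ge0 ?subr_gt0 ?subr_ge0 // ltW.
  move=> E; move: h; rewrite -E => h.
  have [u0|u0|u0] := ltgtP 0 u.1; first by rewrite pmulr_rgt0 in h.
    by apply/negbTE; rewrite -leNgt; move: h; rewrite nmulr_rgt0 // => /ltW.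
  by move: h; rewrite -u0 mul0r ltxx.
rewrite /crossing.
have -> : [&& 0 < signed_area2 p q x, ~~ upper x p & upper x q] =
    [&& 0 < u.1, ~~ upper x p & upper x q].
  by case E : (~~ upper x p && upper x q); rewrite ?andbF // area_sgn.
have -> : [&& 0 < signed_area2 q p x, ~~ upper x q & upper x p] =
    [&& 0 < u.1, ~~ upper x q & upper x p].
  by case E : (~~ upper x q && upper x p); rewrite ?andbF // area_sgn.
by case: (0 < u.1); case: (upper x p); case: (upper x q).
Qed.

Definition tri_crossing x p q r : int :=
  crossing x p q + crossing x q r + crossing x r p.

Lemma area_sum p q r x : signed_area2 p q x + signed_area2 q r x +
  signed_area2 r p x = signed_area2 p q r.
Proof. by rewrite /signed_area2; ring. Qed.

Lemma area_opp p q x : signed_area2 q p x = - signed_area2 p q x.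
Proof. by rewrite /signed_area2; ring. Qed.

(** Up to a common factor the three areas are the barycentric coordinates of [x]; this is the second
    coordinate of that relation. *)
Lemma area_moment p q r x : (p.2 - x.2) * signed_area2 q r x +
  (q.2 - x.2) * signed_area2 r p x + (r.2 - x.2) * signed_area2 p q x = 0.
Proof. by rewrite /signed_area2; ring. Qed.

(** Unless all vertices are on one side of the horizontal line through [x], one side of the triangle
    goes up across it and one goes down. The sum and the moment of the areas show that the upward
    one is counted whenever the downward one is, wherever [x] lies. *)
Lemma tri_crossing_ge0 x p q r : 0 <= signed_area2 p q r ->
  0 <= tri_crossing x p q r.
Proof.
have one_up (y1 y2 y3 a b c : R) : y1 <= 0 -> y2 <= 0 -> 0 < y3 ->
    0 <= a + b + c -> y1 * b + y2 * c + y3 * a = 0 -> c < 0 -> 0 < b.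
  move=> h1 h2 h3 S M hc; rewrite ltNge; apply/negP => hb.
  have : 0 <= y1 * b by rewrite mulr_le0.
  have : 0 <= y2 * c by rewrite mulr_le0 // ltW.
  have : 0 < y3 * a by rewrite pmulr_rgt0 //; lra.
  by lra.
have two_up (y1 y2 y3 a b c : R) : y1 <= 0 -> 0 < y2 -> 0 < y3 ->
    0 <= a + b + c -> y1 * b + y2 * c + y3 * a = 0 -> c < 0 -> 0 < a.
  move=> h1 h2 h3 S M hc; rewrite ltNge; apply/negP => ha.
  have : y1 * b <= 0 by rewrite mulr_le0_ge0 //; lra.
  have : y2 * c < 0 by rewrite pmulr_rlt0.
  have : y3 * a <= 0 by rewrite pmulr_rle0.
  by lra.
move=> pqr; have S := area_sum p q r x; have M := area_moment p q r x.
rewrite /tri_crossing /crossing (area_opp p q) (area_opp q r) (area_opp r p).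
move: S M; set a := signed_area2 p q x; set b := signed_area2 q r x.
set c := signed_area2 r p x; rewrite !oppr_gt0 /upper => S M.
have {}S : 0 <= a + b + c by rewrite S.
have S' : 0 <= b + c + a by lra.
have S'' : 0 <= c + a + b by lra.
have M' : (q.2 - x.2) * c + (r.2 - x.2) * a + (p.2 - x.2) * b = 0 by lra.
have M'' : (r.2 - x.2) * a + (p.2 - x.2) * b + (q.2 - x.2) * c = 0 by lra.
rewrite -(subr_gt0 x.2 p.2) -(subr_gt0 x.2 q.2) -(subr_gt0 x.2 r.2).
case: (ltP 0 (p.2 - x.2)) => hp; case: (ltP 0 (q.2 - x.2)) => hq;
  case: (ltP 0 (r.2 - x.2)) => hr //=; rewrite ?andbF ?andbT //.
- by have := two_up _ _ _ _ _ _ hr hp hq S'' M''; case: (0 < c); case: (b < 0) => // ->.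
- by have := two_up _ _ _ _ _ _ hq hr hp S' M'; case: (0 < b); case: (a < 0) => // ->.
- by have := one_up _ _ _ _ _ _ hq hr hp S' M'; case: (0 < c); case: (a < 0) => // ->.
- by have := two_up _ _ _ _ _ _ hp hq hr S M; case: (0 < a); case: (c < 0) => // ->.
- by have := one_up _ _ _ _ _ _ hr hp hq S'' M''; case: (0 < a); case: (b < 0) => // ->.
- by have := one_up _ _ _ _ _ _ hp hq hr S M; case: (0 < b); case: (c < 0) => // ->.
Qed.

(** With all areas positive no crossing is counted negatively, so it suffices to find an upward one,
    that is, to exclude that all vertices are on one side. *)
Lemma tri_crossing_gt0 x p q r : 0 < signed_area2 p q x ->
  0 < signed_area2 q r x -> 0 < signed_area2 r p x ->
  0 < tri_crossing x p q r.
Proof.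
move=> ha hb hc; have M := area_moment p q r x.
rewrite /tri_crossing /crossing (area_opp p q) (area_opp q r) (area_opp r p).
rewrite !oppr_gt0 ha hb hc !(ltNge _ 0) !(ltW ha, ltW hb, ltW hc) /= /upper.
rewrite -(subr_gt0 x.2 p.2) -(subr_gt0 x.2 q.2) -(subr_gt0 x.2 r.2).
case: (ltP 0 (p.2 - x.2)) => hp; case: (ltP 0 (q.2 - x.2)) => hq;
  case: (ltP 0 (r.2 - x.2)) => hr //=; exfalso.
  have : 0 < (p.2 - x.2) * signed_area2 q r x by rewrite mulr_gt0.
  have : 0 < (q.2 - x.2) * signed_area2 r p x by rewrite mulr_gt0.
  have : 0 < (r.2 - x.2) * signed_area2 p q x by rewrite mulr_gt0.
  by lra.
(* With no vertex above [x], the moment relation puts [p] and [q] at the height of [x], against the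
   positive area of [p q x]. *)
have hpb : (p.2 - x.2) * signed_area2 q r x <= 0 by rewrite mulr_le0_ge0 // ltW.
have hqc : (q.2 - x.2) * signed_area2 r p x <= 0 by rewrite mulr_le0_ge0 // ltW.
have hra : (r.2 - x.2) * signed_area2 p q x <= 0 by rewrite mulr_le0_ge0 // ltW.
have /eqP : (p.2 - x.2) * signed_area2 q r x = 0 by lra.
have /eqP : (q.2 - x.2) * signed_area2 r p x = 0 by lra.
rewrite !mulf_eq0 (gt_eqF hb) (gt_eqF hc) !orbF => /eqP q0 /eqP p0.
move: ha; rewrite /signed_area2.
have -> : x.2 - p.2 = 0 by lra.
have -> : q.2 - p.2 = 0 by lra.
by rewrite mulr0 mul0r subrr ltxx.
Qed.

End Crossing.

(** * Directions and coordinates *)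

Section Directions.
Variable R : realType.
Implicit Types (u p q : R * R) (d k : 'Z_12).

Definition cmul u p : R * R := (u.1 * p.1 - u.2 * p.2, u.1 * p.2 + u.2 * p.1).

Lemma pair_eqP p q : p.1 = q.1 -> p.2 = q.2 -> p = q.
Proof. by case: p q => ? ? [? ?] /= -> ->. Qed.

Lemma cmulDr u p q : cmul u (p + q) = cmul u p + cmul u q.
Proof. by apply: pair_eqP => /=; ring. Qed.

Lemma cmulA u v p : cmul (cmul u v) p = cmul u (cmul v p).
Proof. by apply: pair_eqP => /=; ring. Qed.

Lemma cmulC u v : cmul u v = cmul v u.
Proof. by apply: pair_eqP => /=; ring. Qed.

Lemma unit_stepD m n : unit_step R (m + n) = cmul (unit_step R m) (unit_step R n).
Proof.
rewrite /unit_step natrD mulrDl mulrDl cosD sinD.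
by apply: pair_eqP => //=; rewrite addrC [X in _ + X]mulrC [X in X + _]mulrC.
Qed.

Lemma unit_step180 : unit_step R 180 = (- 1, 0).
Proof.
by rewrite /unit_step mulrAC divff ?mul1r ?pnatr_eq0 // cospi sinpi.
Qed.

Lemma unit_step90 : unit_step R 90 = (0, 1).
Proof.
have -> : (unit_step R 90) = (cos (pi / 2), sin (pi / 2)).
  rewrite /unit_step; have -> : 90%:R * pi / 180%:R = pi / 2%:R :> R by field.
  by [].
by rewrite cos_pihalf sin_pihalf.
Qed.

Lemma unit_step30 : unit_step R 30 = (Num.sqrt 3 / 2, 1 / 2).
Proof.
have := unit_step90.
have -> : 90%N = (30 + (30 + 30))%N by [].
rewrite 2!unit_stepD => -[].
set c := cos _; set s := sin _ => /= h1 h2.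
have pi0 := pi_gt0 R.
have c0 : 0 < c by apply: cos_gt0_pihalf; apply/andP; split; lra.
have s0 : 0 < s by apply: sin_gt0_pi; apply/andP; split; lra.
have cs : c ^+ 2 + s ^+ 2 = 1 by rewrite cos2Dsin2.
(* The cube of the unit step at 30 degrees is the one at 90 degrees, so its real part vanishes. *)
have /eqP : c * (c ^+ 2 - 3 * s ^+ 2) = 0 by rewrite -[RHS]h1; ring.
rewrite mulf_eq0 (gt_eqF c0) /= => /eqP c3s.
have /eqP : (2 * s - 1) * (2 * s + 1) = 0.
  have -> : (2 * s - 1) * (2 * s + 1) = 4 * s ^+ 2 - 1 by ring.
  by lra.
rewrite mulf_eq0 => /orP[/eqP sE|/eqP sE]; last by exfalso; lra.
have sh : s = 1 / 2 by lra.
have ch : 3 = (2 * c) ^+ 2 by rewrite exprMn; move: c3s; rewrite sh; lra.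
rewrite /unit_step -/c -/s ch sqrtr_sqr ger0_norm ?sh; last by lra.
by congr pair; field.
Qed.

Lemma unit_step_mod12 m : unit_step R (30 * (m %% 12)) = unit_step R (30 * m).
Proof.
have u360 : unit_step R 360 = (1, 0).
  have -> : 360%N = (180 + 180)%N by [].
  by rewrite unit_stepD unit_step180; apply: pair_eqP => /=; ring.
rewrite {2}(divn_eq m 12) mulnDr addnC.
elim: (m %/ 12)%N => [|k IH]; first by rewrite mul0n muln0 addn0.
have -> : (30 * (m %% 12) + 30 * (k.+1 * 12) =
  (30 * (m %% 12) + 30 * (k * 12)) + 360)%N by lia.
by rewrite unit_stepD -IH u360; apply: pair_eqP => /=; ring.
Qed.

Definition dir d : R * R := unit_step R (30 * d).

Lemma dirD d k : dir (d + k) = cmul (dir d) (dir k).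
Proof. by rewrite /dir -unit_stepD -mulnDr /= unit_step_mod12. Qed.

Lemma dir0 : dir 0 = (1, 0).
Proof. by rewrite /dir /unit_step /= muln0 mul0r mul0r cos0 sin0. Qed.

Lemma dir1 : dir 1 = (Num.sqrt 3 / 2, 1 / 2).
Proof. exact: unit_step30. Qed.

Lemma dir_dinv d : dir (dinv d) = - dir d.
Proof.
rewrite dirD {2}/dir [X in unit_step _ X](_ : _ = 180%N) // unit_step180.
by apply: pair_eqP => /=; ring.
Qed.

Lemma dir_norm d : (dir d).1 ^+ 2 + (dir d).2 ^+ 2 = 1.
Proof. exact: cos2Dsin2. Qed.

(** * Embedding of the exact coordinates into the real plane *)

Definition ZtoR (z : Z) : R := (int_of_Z z)%:~R.

Lemma ZtoRD y z : ZtoR (y + z) = ZtoR y + ZtoR z.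
Proof. by rewrite /ZtoR rmorphD /= intrD. Qed.

Lemma ZtoRN z : ZtoR (- z) = - ZtoR z.
Proof. by rewrite /ZtoR rmorphN /= mulrNz. Qed.

Lemma ZtoRM y z : ZtoR (y * z) = ZtoR y * ZtoR z.
Proof. by rewrite /ZtoR rmorphM /= intrM. Qed.

Lemma ler_ZtoR y z : (ZtoR y <= ZtoR z) = (y <= z).
Proof. by rewrite /ZtoR ler_int; lia. Qed.

Definition emb (v : vec) : R * R :=
  let: (a0, a1, a2, a3) := v in
  (ZtoR a0 + ZtoR a1 * (Num.sqrt 3 / 2) + ZtoR a2 / 2,
   ZtoR a1 / 2 + ZtoR a2 * (Num.sqrt 3 / 2) + ZtoR a3).

Lemma embE a0 a1 a2 a3 : emb (a0, a1, a2, a3) =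
  (ZtoR a0 + ZtoR a1 * (Num.sqrt 3 / 2) + ZtoR a2 / 2,
   ZtoR a1 / 2 + ZtoR a2 * (Num.sqrt 3 / 2) + ZtoR a3).
Proof. by []. Qed.

Lemma embB v w : emb (v - w) = emb v - emb w.
Proof.
case: v w => [[[a0 a1] a2] a3] [[[b0 b1] b2] b3].
by apply: pair_eqP => /=; rewrite !ZtoRD !ZtoRN; ring.
Qed.

Lemma sqr_sqrt3 : Num.sqrt 3 * Num.sqrt 3 = 3 :> R.
Proof. by rewrite -expr2 sqr_sqrtr. Qed.

Lemma emb_zmul v : emb (zmul v) = cmul (dir 1) (emb v).
Proof.
case: v => [[[a0 a1] a2] a3]; rewrite dir1 /zmul !embE ZtoRD ZtoRN; have := sqr_sqrt3.
set s := Num.sqrt 3 => s3.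
have mod3 x y a : x - y = a * (s * s - 3) -> x = y.
  by rewrite s3 subrr mulr0 => /eqP; rewrite subr_eq0 => /eqP.
apply: pair_eqP => /=.
  by apply: (mod3 _ _ (- ZtoR a1 / 4)); field.
by apply: (mod3 _ _ (- ZtoR a2 / 4)); field.
Qed.

Lemma emb_zrot d v : emb (zrot d v) = cmul (dir d) (emb v).
Proof.
rewrite -{2}[d]natr_Zp /zrot; elim: (nat_of_ord d) => [|n IH] /=.
  by rewrite dir0; apply: pair_eqP => /=; ring.
by rewrite emb_zmul IH -cmulA -dirD -natr1 addrC.
Qed.

Lemma emb_zunit d : emb (zunit d) = dir d.
Proof.
rewrite /zunit emb_zrot embE.
have -> : ZtoR 1 = 1 by [].
have -> : ZtoR 0 = 0 by [].
by apply: pair_eqP => /=; ring.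
Qed.

End Directions.

(** Any initial piece of a substituted path consists of the whole images of some letters and a piece
    of the image of the next one; this is how estimates pass from one level to another. *)
Lemma take_lpath n w r x0 : w != [::] -> exists k s, (k < size w)%N /\
  take r (lpath n w) = lpath n (take k w) ++ take s (lpath n [:: nth x0 w k]).
Proof.
elim: w r => // y w IH r _.
have short : (r <= size (lpath n [:: y]))%N || (w == [::]) ->
    exists k s, (k < size (y :: w))%N /\ take r (lpath n (y :: w)) =
      lpath n (take k (y :: w)) ++ take s (lpath n [:: nth x0 (y :: w) k]).
  move=> h; exists 0%N, r; split=> //=; rewrite lpath_nil.
  case/orP: h => [h|/eqP -> //].
  rewrite -cat1s lpath_cat take_cat; case: ltnP => // h'.
  have -> : r = size (lpath n [:: y]) by apply/eqP; rewrite eqn_leq h h'.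
  by rewrite subnn take0 cats0 take_size.
case: (boolP ((r <= size (lpath n [:: y]))%N || (w == [::]))) => [/short //|].
rewrite negb_or -ltnNge => /andP[h w0].
have [k [s [kw E]]] := IH (r - size (lpath n [:: y]))%N w0.
exists k.+1, s; split=> //.
rewrite -cat1s lpath_cat take_cat ltnNge (ltnW h) /= E.
by rewrite -[y :: take k w]cat1s lpath_cat catA.
Qed.

Lemma wdisp_morph (L : Type) (V W : zmodType) (f : V -> W) (D : L -> V) w :
  f 0 = 0 -> (forall u v, f (u + v) = f u + f v) ->
  foldr (fun x v => f (D x) + v) 0 w = f (foldr (fun x v => D x + v) 0 w).
Proof. by move=> f0 fD; elim: w => //= x w ->; rewrite fD. Qed.

(** The values are (7, -8), (1, -1), (1, 0), (7, 1), and so on: the start is obtained by running the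
    recursion backwards from (1, 0), for which the displacement at level 4 is [vecP] plus [vecC].
    From [i = 2] on no entry is negative, hence [i.+2] in the estimates. *)
Fixpoint scale (i : nat) : int * int :=
  if i is i'.+1 then let s := scale i' in (s.1 * 7 + s.2 * 6, s.1 + s.2)
  else (7, - 8%:Z).

Lemma scaleS i : scale i.+1 =
  ((scale i).1 * 7 + (scale i).2 * 6, (scale i).1 + (scale i).2).
Proof. by []. Qed.

Lemma scale_ge i : (i%:Z + 1 <= (scale i.+2).1) && (0 <= (scale i.+2).2).
Proof.
elim: i => // i; rewrite (scaleS i.+2).
by move: (scale i.+2).1 (scale i.+2).2 => l m IH; rewrite [_.1]/= [_.2]/=; lia.
Qed.

Lemma vec_subst2 w :
  [/\ wdisp vecP (subst2 w) = wdisp vecP w *+ 7 + wdisp vecQ w,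
      wdisp vecQ (subst2 w) = wdisp vecP w *+ 6 + wdisp vecQ w &
      wdisp vecC (subst2 w) = wdisp vecC w].
Proof.
elim: w => [|x w [IHP IHQ IHC]]; first by rewrite /= !mul0rn !addr0.
have -> : subst2 (x :: w) = subst2 [:: x] ++ subst2 w.
  by rewrite -cat1s /subst2 !subst_cat.
have [xP xQ xC] := vec_subst2_letter x.
rewrite !wdisp_cat IHP IHQ IHC xP xQ xC /= !mulrnDl.
by split => //; rewrite addrACA.
Qed.

Lemma lpath_subst2 i w : lpath (2 * i.+1) w = lpath (2 * i) (subst2 w).
Proof. by rewrite mulnS -!lpathS. Qed.

Lemma vec_lpath i w : wdisp zunit (lpath (2 * i) w) =
  wdisp vecP w *~ (scale i).1 + wdisp vecQ w *~ (scale i).2 + wdisp vecC w.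
Proof.
elim: i w => [|i IH] w.
  rewrite /lpath -wdisp_flatten; elim: w => [|x w /= ->].
    by rewrite /= !mul0rz !addr0.
  rewrite vec_ev_letter /= !mulrzDl !pmulrn -mulrNz.
  rewrite addrACA; congr (_ + _); exact: addrACA.
rewrite lpath_subst2 IH; have [-> -> ->] := vec_subst2 w.
move: (wdisp vecP w) (wdisp vecQ w) => P Q; rewrite scaleS.
move: (scale i).1 (scale i).2 => l m; congr (_ + _).
have E n k : P *+ n *~ k = P *~ (k * n%:Z) by rewrite mulrC mulrzA.
have /(_ 7%N l) E7 := E; have /(_ 6%N m) E6 := E.
move: E7 E6; move: (P *+ 7) (P *+ 6) => P7 P6 E7 E6.
by rewrite !mulrzDl !mulrzDr E7 E6 addrACA.
Qed.

(** * The outlines escape to infinity *)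

Section Growth.
Variable R : realType.
Implicit Types (u p q : R * R) (d k : 'Z_12).

Local Notation dir := (@dir R).
Local Notation emb := (@emb R).
Local Notation disp w := (wdisp dir w).
Local Notation ldisp n w := (wdisp dir (lpath n w)).

Definition lam (i : nat) : R := (scale i).1%:~R.
Definition mu (i : nat) : R := (scale i).2%:~R.

Lemma embD v w : emb (v + w) = emb v + emb w.
Proof.
case: v w => [[[a0 a1] a2] a3] [[[b0 b1] b2] b3].
by rewrite !embE !ZtoRD; apply: pair_eqP => /=; ring.
Qed.

Lemma emb0 : emb 0 = 0.
Proof. by rewrite -[X in emb X](subrr (0 : vec)) embB subrr. Qed.

Lemma embMz v (n : int) : emb (v *~ n) = n%:~R *: emb v.
Proof.
have embMn m : emb (v *+ m) = m%:R *: emb v.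
  by elim: m => [|m IH]; rewrite ?emb0 ?scale0r // mulrS embD IH mulrS scalerDl scale1r.
case: n => n; first exact: embMn.
by rewrite NegzE !mulrNz -sub0r embB emb0 sub0r -pmulrn embMn scaleNr.
Qed.

Lemma wdisp_emb w : disp w = emb (wdisp zunit w).
Proof.
rewrite -(wdisp_morph zunit w emb0 embD) /wdisp.
by elim: w => //= x w ->; rewrite emb_zunit.
Qed.

Lemma ldispE i w : ldisp (2 * i) w = lam i *: emb (wdisp vecP w) +
  mu i *: emb (wdisp vecQ w) + emb (wdisp vecC w).
Proof. by rewrite wdisp_emb vec_lpath !embD !embMz. Qed.

Definition height d p : R := dotp (dir d) p.

Lemma heightD d p q : height d (p + q) = height d p + height d q.
Proof. by rewrite /height /dotp /=; ring. Qed.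

Lemma heightN d p : height d (- p) = - height d p.
Proof. by rewrite /height /dotp /=; ring. Qed.

Lemma height0 d : height d 0 = 0.
Proof. by rewrite /height /dotp /= !mulr0 addr0. Qed.

Lemma heightZ d a p : height d (a *: p) = a * height d p.
Proof. by rewrite /height /dotp /= /GRing.scale /=; ring. Qed.

Lemma dirN d : dir (- d) = ((dir d).1, - (dir d).2).
Proof.
have := dirD R d (- d); rewrite subrr dir0; have := dir_norm R d.
move: (dir d) (dir (- d)) => [x y] [a b] /= h3 [h1 h2].
have ha : a = x * (x * a - y * b) + y * (x * b + y * a).
  by rewrite -[LHS]mulr1 -h3; ring.
have hb : b = x * (x * b + y * a) - y * (x * a - y * b).
  by rewrite -[LHS]mulr1 -h3; ring.
by congr pair; [rewrite ha | rewrite hb]; rewrite -h1 -h2; ring.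
Qed.

Lemma height_emb d v : height d (emb v) = (emb (zrot (- d) v)).1.
Proof. by rewrite emb_zrot dirN /height /dotp /=; ring. Qed.

Lemma height_dir_ge d k : -1 <= height d (dir k).
Proof.
have := dir_norm R d; have := dir_norm R k; rewrite /height /dotp.
move: (dir d) (dir k) => [x y] [a b] /= h1 h2.
have : 0 <= (x + a) ^+ 2 + (y + b) ^+ 2 by rewrite addr_ge0 ?sqr_ge0.
have -> : (x + a) ^+ 2 + (y + b) ^+ 2 =
  (x ^+ 2 + y ^+ 2) + (a ^+ 2 + b ^+ 2) + 2 * (x * a + y * b) by ring.
by rewrite h1 h2; lra.
Qed.

Lemma height_disp_ge d w : - (size w)%:R <= height d (disp w).
Proof.
elim: w => [|k w IH] /=; first by rewrite height0 oppr0.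
by rewrite heightD; have := height_dir_ge d k; rewrite -natr1; lra.
Qed.

Lemma sqrt3_bounds : 71 / 41 <= (Num.sqrt 3 : R) <= 26 / 15.
Proof.
apply/andP; split; rewrite -(@ler_pXn2r _ 2) ?nnegrE ?sqrtr_ge0 // ?sqr_sqrtr //; lra.
Qed.

Lemma zlo_le v : ZtoR R (zlo v) <= 1230 * (emb v).1.
Proof.
case: v => [[[a0 a1] a2] a3]; have /andP[s1 s2] := sqrt3_bounds.
have -> : zlo (a0, a1, a2, a3) =
  615%BZ * (2%BZ * a0 + a2) + (if (0 <=? a1)%BZ then 1065%BZ else 1066%BZ) * a1 by [].
rewrite ZtoRD ZtoRM ZtoRD ZtoRM.
have -> : ZtoR R (2%BZ) = 2 by [].
have -> : ZtoR R (615%BZ) = 615 by [].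
have := ler_ZtoR R 0 a1; have -> : ZtoR R 0 = 0 by [].
case: Z.leb_spec => a10 a1s; rewrite ZtoRM.
  have a1p : 0 <= ZtoR R a1 by rewrite a1s; lia.
  have -> : ZtoR R (1065%BZ) = 1065 by [].
  have : 0 <= ZtoR R a1 * (Num.sqrt 3 - 71 / 41) by rewrite mulr_ge0 // subr_ge0.
  rewrite embE [_.1]/=; lra.
have a1n : ZtoR R a1 <= 0.
  by have -> : 0 = ZtoR R 0 by []; rewrite ler_ZtoR; lia.
have -> : ZtoR R (1066%BZ) = 1066 by [].
have : 0 <= ZtoR R a1 * (Num.sqrt 3 - 26 / 15) by rewrite mulr_le0 // subr_le0.
by rewrite embE [_.1]/=; lra.
Qed.

Lemma height_zlo d v : ZtoR R (zlo (zrot (- d) v)) <= 1230 * height d (emb v).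
Proof. by rewrite height_emb zlo_le. Qed.

Lemma lam_ge i : i.+1%:R <= lam i.+2.
Proof. by rewrite /lam -[i.+1%:R]/(i.+1%:~R) ler_int; have := scale_ge i; lia. Qed.

Lemma mu_ge0 i : 0 <= mu i.+2.
Proof. by rewrite /mu ler0z; have := scale_ge i; lia. Qed.

Lemma lamS i : lam i.+1 = lam i * 7 + mu i * 6.
Proof. by rewrite /lam /mu scaleS [_.1]/= intrD !intrM. Qed.

Lemma muS i : mu i.+1 = lam i + mu i.
Proof. by rewrite /lam /mu scaleS [_.2]/= intrD. Qed.

Lemma ZtoR_const a b c :
  ZtoR R (a * (b * c))%BZ = ZtoR R a * (ZtoR R b * ZtoR R c).
Proof. by rewrite -!ZtoRM. Qed.

(** As [lam i.+2] is at least 1, the negative part of the constant term [V] can be charged to the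
    coefficient of [P]. *)
Lemma combine_height d (P Q V : vec) (i : nat) (a b : R) :
  a * 1230 <= ZtoR R (zlo (zrot (- d) P) + Order.min 0 (zlo (zrot (- d) V))) ->
  b * 1230 <= ZtoR R (zlo (zrot (- d) Q)) ->
  a * lam i.+2 + b * mu i.+2 <=
    height d (lam i.+2 *: emb P + mu i.+2 *: emb Q + emb V).
Proof.
rewrite !heightD !heightZ ZtoRD => hPV hQ.
have hP := height_zlo d P; have {}hQ := le_trans hQ (height_zlo d Q).
have hV := height_zlo d V.
have hm0 : ZtoR R (Order.min 0 (zlo (zrot (- d) V))) <= 0.
  by rewrite (_ : 0 = ZtoR R 0) // ler_ZtoR ge_min lexx.
have hmV : ZtoR R (Order.min 0 (zlo (zrot (- d) V))) <= ZtoR R (zlo (zrot (- d) V)).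
  by rewrite ler_ZtoR ge_min lexx orbT.
move: hP hQ hV hPV hm0 hmV.
move: (ZtoR R (Order.min _ _)) (ZtoR R (zlo _)) (ZtoR R (zlo _)) => M zP zV.
move: (height d (emb P)) (height d (emb Q)) (height d (emb V)).
have l1 : 1 <= lam i.+2.
  by apply: le_trans (lam_ge i); rewrite (_ : 1 = 1%:R) // ler_nat.
have m0 := mu_ge0 i; move: (lam i.+2) (mu i.+2) l1 m0.
move=> l m l1 m0 hP hQ hV HP HQ HV hPV hm0 hmV.
have h1 : 0 <= l * (1230 * hP + M - a * 1230) by rewrite mulr_ge0; lra.
have h2 : 0 <= m * (1230 * hQ - b * 1230) by rewrite mulr_ge0; lra.
have h3 : 0 <= (l - 1) * - M by rewrite mulr_ge0; lra.
lra.
Qed.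

(** One step of the recursion turns [8 * lam + 7 * mu] into [63 * lam + 55 * mu], an increase by
    [55 * lam + 48 * mu]; 35 times this increase is what a proper prefix of a twice substituted
    letter may cost. The ratio 8 : 7 approximates the eigenvector for 4 + sqrt 15. *)
Lemma arc_excursion i d x r : d \in dirs ->
  - (35 * (8 * lam i.+2 + 7 * mu i.+2) + 1000) <=
  height d (disp (take r (lpath (2 * i.+2) [:: x]))).
Proof.
move=> d_in; elim: i x r => [|i IH] x r.
  have := height_disp_ge d (take r (lpath (2 * 2) [:: x])).
  have sz : ((size (take r (lpath (2 * 2) [:: x])))%:R <= 1000 :> R).
    rewrite ler_nat; apply: leq_trans (size_lpath4 x); rewrite size_take.
    by case: ifP => // /ltnW.
  rewrite /lam /mu /=; lra.
rewrite lpath_subst2.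
have [w0|w0] := eqVneq (subst2 [:: x]) [::].
  rewrite w0 lpath_nil [disp _]/= height0.
  have := lam_ge i.+1; have := mu_ge0 i.+1; have := ler0n R i.+2; lra.
have [k [s [kw ->]]] := take_lpath (2 * i.+2) r x w0.
rewrite wdisp_cat heightD.
have := IH (nth x (subst2 [:: x]) k) s; set E := height d (disp (take s _)).
move=> hE; rewrite ldispE.
have [] := zlo_subst2 d_in kw; set v := take k _.
rewrite -!(ler_ZtoR R) !ZtoRN !ZtoR_const => hPC hQ.
have -> : - (35 * (8 * lam i.+3 + 7 * mu i.+3) + 1000) =
  (- (55 * 35) * lam i.+2 + - (48 * 35) * mu i.+2) +
  - (35 * (8 * lam i.+2 + 7 * mu i.+2) + 1000).
  by rewrite (lamS i.+2) (muS i.+2); ring.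
apply: lerD hE; apply: combine_height.
  apply: le_trans hPC; rewrite (_ : ZtoR R 1230%BZ = 1230) //.
  by rewrite (_ : ZtoR R 55%BZ = 55) // (_ : ZtoR R 35%BZ = 35) //; lra.
apply: le_trans hQ; rewrite (_ : ZtoR R 1230%BZ = 1230) //.
by rewrite (_ : ZtoR R 48%BZ = 48) // (_ : ZtoR R 35%BZ = 35) //; lra.
Qed.

(* The base point at which the cluster of level [2 i] contains the previous one,
   normalised so that the recursion of [centerS] has no constant term. *)
Definition center (i : nat) : R * R :=
  (- (lam i / 6)) *: emb (wdisp vecQ wcenter) +
  mu i *: (emb (wdisp vecQ wcenter) - emb (wdisp vecP wcenter)).

Lemma centerS i : center i.+1 = center i - ldisp (2 * i) wcenter.
Proof.
rewrite ldispE vecC_wcenter emb0 addr0 /center lamS muS.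
move: (emb _) (emb _) => [q1 q2] [p1 p2].
by apply: pair_eqP; rewrite /= /GRing.scale /=; field.
Qed.

Lemma outline_vertex_far i (k : nat) : (k < 90)%N ->
  40 * (8 * lam i.+2 + 7 * mu i.+2) <=
  height (outline_dir k) (center i.+3 + ldisp (2 * i.+2) (take k outline)).
Proof.
move=> /outline_far[]; set v := take k _; set d := outline_dir k.
rewrite -!(ler_ZtoR R) !ZtoR_const => hP hQ.
have E6 : 6 *: (center i.+3 + ldisp (2 * i.+2) v) =
    lam i.+2 *: emb (wdisp vecP v *+ 6 - wdisp vecP wcenter *+ 6 - wdisp vecQ wcenter) +
    mu i.+2 *: emb (wdisp vecQ v *+ 6 - wdisp vecP wcenter *+ 6) +
    emb (wdisp vecC v *+ 6).
  rewrite centerS !ldispE vecC_wcenter emb0 addr0 /center.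
  move: (wdisp vecP v) (wdisp vecQ v) (wdisp vecC v).
  move: (wdisp vecP wcenter) (wdisp vecQ wcenter) => Pw Qw P Q V.
  have emb6 X : emb (X *+ 6) = 6 *: emb X by rewrite pmulrn embMz.
  rewrite !embB !emb6; move: (emb P) (emb Q) (emb V) (emb Pw) (emb Qw).
  move=> [a1 a2] [b1 b2] [c1 c2] [p1 p2] [q1 q2].
  by apply: pair_eqP; rewrite /= /GRing.scale /=; field.
have := @combine_height d
  (wdisp vecP v *+ 6 - wdisp vecP wcenter *+ 6 - wdisp vecQ wcenter)
  (wdisp vecQ v *+ 6 - wdisp vecP wcenter *+ 6) (wdisp vecC v *+ 6)
  i (48 * 40) (42 * 40).
rewrite -E6 heightZ => h.
suff : 48 * 40 * lam i.+2 + 42 * 40 * mu i.+2 <=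
   6 * height d (center i.+3 + ldisp (2 * i.+2) v) by lra.
apply: h.
  apply: le_trans hP; rewrite (_ : ZtoR R 1230%BZ = 1230) //.
  by rewrite (_ : ZtoR R 48%BZ = 48) // (_ : ZtoR R 40%BZ = 40) //; lra.
apply: le_trans hQ; rewrite (_ : ZtoR R 1230%BZ = 1230) //.
by rewrite (_ : ZtoR R 42%BZ = 42) // (_ : ZtoR R 40%BZ = 40) //; lra.
Qed.

(** The height of a vertex, at least 40 units, less the descent along the arc after it, at most 35
    units and 1000, leaves 5 units less 1000. *)
Lemma outline_segment_far i a b r d : (a < b <= 90)%N ->
  (forall k : nat, (a <= k < b)%N -> outline_dir k = d) -> d \in dirs ->
  5 * (8 * lam i.+2 + 7 * mu i.+2) - 1000 <= height d (center i.+3 +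
    ldisp (2 * i.+2) (take a outline) +
    disp (take r (lpath (2 * i.+2) (drop a (take b outline))))).
Proof.
move=> /andP[ab b90] hd d_in.
have szo : size outline = 90%N by vm_compute.
have szs : size (drop a (take b outline)) = (b - a)%N.
  by rewrite size_drop size_takel ?szo.
have w0 : drop a (take b outline) != [::] by rewrite -size_eq0 szs; lia.
have [k [s [kw ->]]] := take_lpath (2 * i.+2) r (0%N, true, 0) w0.
rewrite szs in kw; have kb : (a <= a + k < b)%N by lia.
have E1 : take (a + k) outline = take a outline ++ take k (drop a (take b outline)).
  by rewrite takeD !take_drop take_takel //; lia.
rewrite wdisp_cat addrA -(addrA (center _)) -wdisp_cat -lpath_cat -E1 heightD.
have h2 := @arc_excursion i d (nth (0%N, true, 0) (drop a (take b outline)) k) s d_in.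
have k90 : (a + k < 90)%N by lia.
have := @outline_vertex_far i _ k90; rewrite hd // => h1.
by lra.
Qed.

Definition step_crossing x q d : int := crossing x q (q + dir d).

Lemma wsum_halfplane x u p w :
  (forall r, 0 < dotp u (p + disp (take r w) - x)) ->
  wsum dir (step_crossing x) p w =
  if 0 < u.1 then (upper x (p + disp w))%:Z - (upper x p)%:Z else 0.
Proof.
elim: w p => [|k w IH] p far /=; first by rewrite addr0 subrr; case: ifP.
rewrite {1}/step_crossing (crossing_halfplane (u := u)).
- rewrite IH ?addrA; first by case: ifP => // _; ring.
  by move=> r; have := far r.+1; rewrite /= addrA.
- by have := far 0%N; rewrite /= addr0.
- by have := far 1%N; rewrite /= take0 /= addr0.
Qed.

Lemma dir4 : dir 4%:R = (- (1 / 2), Num.sqrt 3 / 2).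
Proof.
rewrite /dir [X in unit_step _ X](_ : _ = 30 + 90)%N //.
by rewrite unit_stepD unit_step30 unit_step90; apply: pair_eqP => /=; ring.
Qed.

Lemma dir8 : dir 8%:R = (- (1 / 2), - (Num.sqrt 3 / 2)).
Proof.
have -> : 8%:R = 4%:R + 4%:R :> 'Z_12 by exact/val_inj.
rewrite dirD dir4; have := sqr_sqrt3 R; set s := Num.sqrt 3 => s3.
by apply: pair_eqP => /=; lra.
Qed.

(** Only the stretch facing direction 0 can cross the half-line to the right of [x]. Its first
    vertex, 17, is also in the half-plane of direction 4, hence above [x]; its end, 51, is also in
    that of direction 8, hence below. One downward crossing remains. *)
Lemma center_winding (B : R) : exists i0, forall i x, (i0 <= i)%N ->
  `|x.1| <= B -> `|x.2| <= B ->
  wsum dir (step_crossing x) (center i)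
    (lpath (2 * i) (rhex Theta 3%:R)) = -1.
Proof.
exists ((Num.truncn (2 * B + 1000)).+4)%N => i x; case: i => [//|[//|[//|i]]] hi hx1 hx2.
rewrite lpath_subst2 -/outline.
have B0 : 0 <= B := le_trans (normr_ge0 _) hx1.
have lamB : 2 * B < 5 * (8 * lam i.+2 + 7 * mu i.+2) - 1000.
  have := truncnS_gt (2 * B + 1000); have := lam_ge i; have := mu_ge0 i.
  have : ((Num.truncn (2 * B + 1000)).+1%:R <= i.+1%:R :> R) by rewrite ler_nat; lia.
  by lra.
have hx d : height d x <= 2 * B.
  have := dir_norm R d; rewrite /height /dotp; move: (dir d) => [c s] /= cs.
  have c1 : `|c| <= 1.
    by rewrite -(@expr_le1 _ 2) // real_normK ?num_real // -cs lerDl sqr_ge0.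
  have s1 : `|s| <= 1.
    by rewrite -(@expr_le1 _ 2) // real_normK ?num_real // -cs lerDr sqr_ge0.
  have le1 (a b : R) : `|a| <= 1 -> `|b| <= B -> a * b <= B.
    move=> a1 b1; apply: le_trans (ler_norm _) _; rewrite normrM -[leRHS]mul1r.
    exact: ler_pM.
  by have := le1 _ _ c1 hx1; have := le1 _ _ s1 hx2; lra.
have seg a b d : (a < b <= 90)%N -> (forall k : nat, (a <= k < b)%N -> outline_dir k = d) ->
    d \in dirs -> forall r, 0 < dotp (dir d) (center i.+3 +
      ldisp (2 * i.+2) (take a outline) +
      disp (take r (lpath (2 * i.+2) (drop a (take b outline)))) - x).
  move=> ab hd d_in r; have := @outline_segment_far i a b r d ab hd d_in.
  have E q : dotp (dir d) (q - x) = height d q - height d x.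
    by rewrite -[LHS]/(height d _) heightD heightN.
  by rewrite E; have := hx d; lra.
have s1 : forall k : nat, (0 <= k < 17)%N -> outline_dir k = 4%:R.
  by move=> k /andP[_ k17]; rewrite /outline_dir k17.
have s2 : forall k : nat, (17 <= k < 51)%N -> outline_dir k = 0.
  move=> k hk; have h1 : (k < 17)%N = false by lia.
  by rewrite /outline_dir h1 ifT //; lia.
have s3 : forall k : nat, (51 <= k < 73)%N -> outline_dir k = 8%:R.
  move=> k hk; have [h1 h2] : (k < 17)%N = false /\ (k < 51)%N = false by lia.
  by rewrite /outline_dir h1 h2 ifT //; lia.
have s4 : forall k : nat, (73 <= k < 90)%N -> outline_dir k = 4%:R.
  move=> k hk; have [h1 h2] : (k < 17)%N = false /\ (k < 51)%N = false by lia.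
  by rewrite /outline_dir h1 h2 ifF //; lia.
have outline4 : outline = drop 0 (take 17 outline) ++ drop 17 (take 51 outline) ++
    drop 51 (take 73 outline) ++ drop 73 (take 90 outline).
  by apply/eqP; vm_compute.
have {}s1 := seg 0%N 17%N _ isT s1 isT; have {}s2 := seg 17%N 51%N _ isT s2 isT.
have {}s3 := seg 51%N 73%N _ isT s3 isT; have {}s4 := seg 73%N 90%N _ isT s4 isT.
move: outline4 s1 s2 s3 s4 {seg}; move: outline => w w4 s1 s2 s3 s4.
set P := center i.+3; set n := (2 * i.+2)%N.
pose G a := P + ldisp n (take a w).
have GE a b : (a <= b)%N -> G a + ldisp n (drop a (take b w)) = G b.
  move=> ab; rewrite /G -addrA -wdisp_cat -lpath_cat.
  by rewrite -{1}(take_takel w ab) cat_take_drop.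
have G0 : G 0%N = P by rewrite /G take0 lpath_nil addr0.
rewrite -[in LHS]G0 [w in lpath n w]w4 !lpath_cat !wsum_cat !GE //.
rewrite (wsum_halfplane s1) (wsum_halfplane s2) (wsum_halfplane s3).
rewrite (wsum_halfplane s4) -!/(G _).
have -> : 0 < (dir 0).1 by rewrite dir0.
have -> : (0 < (dir 4%:R).1) = false.
  by apply/negbTE; rewrite dir4 -leNgt [_.1]/=; lra.
have -> : (0 < (dir 8%:R).1) = false.
  by apply/negbTE; rewrite dir8 -leNgt [_.1]/=; lra.
rewrite add0r !addr0 GE //.
have start d a b : (forall r, 0 < dotp (dir d) (G a +
    disp (take r (lpath n (drop a (take b w)))) - x)) ->
    0 < dotp (dir d) (G a - x).
  by move=> /(_ 0%N); rewrite take0 addr0.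
have stop d a b : (a <= b)%N -> (forall r, 0 < dotp (dir d) (G a +
    disp (take r (lpath n (drop a (take b w)))) - x)) ->
    0 < dotp (dir d) (G b - x).
  by move=> ab /(_ (size (lpath n (drop a (take b w))))); rewrite take_size GE.
have sqrt3 : 0 < Num.sqrt 3 :> R by rewrite sqrtr_gt0.
have u17 : upper x (G 17%N).
  have := @stop _ 0%N 17%N isT s1; have := start _ _ _ s2.
  rewrite dir0 dir4; move: (G 17%N) => g; rewrite /dotp /upper /= => h1 h2.
  have : 0 < Num.sqrt 3 / 2 * (g.2 - x.2) by lra.
  by rewrite pmulr_rgt0 ?divr_gt0 // subr_gt0.
have u51 : upper x (G 51%N) = false.
  have := @stop _ 17%N 51%N isT s2; have := start _ _ _ s3.
  rewrite dir0 dir8; move: (G 51%N) => g; rewrite /dotp /upper /= => h1 h2.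
  have : 0 < Num.sqrt 3 / 2 * (x.2 - g.2) by lra.
  by rewrite pmulr_rgt0 ?divr_gt0 // subr_gt0 => h; apply/negbTE; rewrite -leNgt ltW.
by rewrite u17 u51.
Qed.

End Growth.

(** * Winding numbers of polygons *)

Section Polygons.
Variable R : realType.
Implicit Types (p q r u x y : R * R) (s : seq (R * R)).

Definition winding x s : int :=
  \sum_(k < size s) crossing x s`_k s`_(k.+1 %% size s).

Lemma sum_cyclic (A : zmodType) (phi : R * R -> A) s :
  \sum_(k < size s) phi s`_(k.+1 %% size s) = \sum_(k < size s) phi s`_k.
Proof.
case: (size s) => [|n]; first by rewrite !big_ord0.
rewrite big_ord_recr big_ord_recl /= modnn addrC; congr (_ + _).
by apply: eq_bigr => k _; rewrite modn_small // ltnS ltn_ord.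
Qed.

Lemma winding_halfplane u x s : (forall k, (k < size s)%N -> 0 < dotp u (s`_k - x)) ->
  winding x s = 0.
Proof.
move=> hu; have mods (k : 'I_(size s)) : (k.+1 %% size s < size s)%N.
  by rewrite ltn_mod (leq_ltn_trans _ (ltn_ord k)).
have E (k : 'I_(size s)) : crossing x s`_k s`_(k.+1 %% size s) =
    if 0 < u.1 then (upper x s`_(k.+1 %% size s))%:Z - (upper x s`_k)%:Z else 0.
  by apply: crossing_halfplane; apply: hu.
rewrite /winding (eq_bigr _ (fun k _ => E k)); case: (0 < u.1); last by rewrite big1.
by rewrite sumrB (sum_cyclic (fun p => (upper x p)%:Z)) subrr.
Qed.

Lemma crossing_translate x p q : crossing x p q = crossing 0 (p - x) (q - x).
Proof.
have area a b : signed_area2 (a - x) (b - x) 0 = signed_area2 a b x.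
  by rewrite /signed_area2 /=; ring.
by rewrite /crossing !area /upper /= !subr_gt0.
Qed.

Lemma near_dotp u p x : 0 < dotp u (p - x) -> \forall y \near x, 0 < dotp u (p - y).
Proof.
move=> h; pose e := dotp u (p - x) / (`|u.1| + `|u.2| + 1).
have d0 : 0 < `|u.1| + `|u.2| + 1 by rewrite ltr_wpDl ?addr_ge0.
have e0 : 0 < e by rewrite divr_gt0.
near=> y.
have [y1 y2] : `|x.1 - y.1| < e /\ `|x.2 - y.2| < e.
  have : ball x e y by near: y; exact: (@nbhsx_ballx R _ x e e0).
  by case; rewrite -!ball_normE.
have -> : dotp u (p - y) = dotp u (p - x) + (u.1 * (x.1 - y.1) + u.2 * (x.2 - y.2)).
  by rewrite /dotp /=; ring.
have h1 : - (`|u.1| * e) <= u.1 * (x.1 - y.1).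
  by rewrite lerNl (le_trans (ler_norm _)) // normrN normrM ler_wpM2l // ltW.
have h2 : - (`|u.2| * e) <= u.2 * (x.2 - y.2).
  by rewrite lerNl (le_trans (ler_norm _)) // normrN normrM ler_wpM2l // ltW.
have : (`|u.1| + `|u.2| + 1) * e = dotp u (p - x).
  by rewrite /e mulrC divfK // gt_eqF.
by rewrite !mulrDl mul1r; lra.
Unshelve. all: by end_near. Qed.

(** If [x] is off the line, a normal to the line separates; if it is on the line, it lies beyond an
    end of the segment and [q - p] or its opposite separates. *)
Lemma segment_separation p q x : ~ line_segment p q x ->
  exists u, 0 < dotp u (p - x) /\ 0 < dotp u (q - x).
Proof.
move=> npq.
have [pq|] := eqVneq p q.
  rewrite -pq; exists (p - x).
  suff px : p - x != 0.
    have : 0 < (p - x).1 ^+ 2 + (p - x).2 ^+ 2.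
      rewrite lt_neqAle addr_ge0 ?sqr_ge0 // andbT eq_sym paddr_eq0 ?sqr_ge0 //.
      rewrite !sqrf_eq0; apply: contra px => /andP[/eqP h1 /eqP h2].
      by apply/eqP; case: (p - x) h1 h2 => ? ? /= -> ->.
    by rewrite /dotp -!expr2.
  apply/negP => /eqP/subr0_eq px; apply: npq; exists 0.
    by rewrite /= in_itv /= lexx ler01.
  by rewrite subr0 scale1r scale0r addr0.
move=> pq.
pose n : R * R := (- (q.2 - p.2), q.1 - p.1).
have np : dotp n (p - x) = dotp n (q - x) by rewrite /dotp /n /=; ring.
have [h|h|h] := ltgtP (dotp n (p - x)) 0; last 1 first.
- pose d := q - p.
  have D0 : 0 < d.1 ^+ 2 + d.2 ^+ 2.
    rewrite lt_neqAle addr_ge0 ?sqr_ge0 // andbT eq_sym paddr_eq0 ?sqr_ge0 //.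
    rewrite !sqrf_eq0; apply: contra pq => /andP[/eqP h1 /eqP h2].
    by rewrite eq_sym -subr_eq0; apply/eqP; rewrite -/d; case: (d) h1 h2 => ? ? /= -> ->.
  (* The parameter of [x] on the line, by orthogonal projection. *)
  pose t := dotp d (x - p) / (d.1 ^+ 2 + d.2 ^+ 2).
  have xE : x = (1 - t) *: p + t *: q.
    have tD : t * (d.1 ^+ 2 + d.2 ^+ 2) = dotp d (x - p) by rewrite divfK // gt_eqF.
    have D1 : (x.1 - p.1 - t * d.1) * (d.1 ^+ 2 + d.2 ^+ 2) = 0.
      have -> : (x.1 - p.1 - t * d.1) * (d.1 ^+ 2 + d.2 ^+ 2) =
        (x.1 - p.1) * (d.1 ^+ 2 + d.2 ^+ 2) - d.1 * (t * (d.1 ^+ 2 + d.2 ^+ 2)) by ring.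
      rewrite tD -[RHS](mulr0 d.2) -h /dotp /n /d /=; ring.
    have D2 : (x.2 - p.2 - t * d.2) * (d.1 ^+ 2 + d.2 ^+ 2) = 0.
      have -> : (x.2 - p.2 - t * d.2) * (d.1 ^+ 2 + d.2 ^+ 2) =
        (x.2 - p.2) * (d.1 ^+ 2 + d.2 ^+ 2) - d.2 * (t * (d.1 ^+ 2 + d.2 ^+ 2)) by ring.
      rewrite tD -[RHS](mulr0 (- d.1)) -h /dotp /n /d /=; ring.
    move/eqP: D1; move/eqP: D2; rewrite !mulf_eq0 (gt_eqF D0) !orbF.
    move=> /eqP E2 /eqP E1; rewrite /d /= in E1 E2.
    case: (x) (p) (q) E1 E2 => [x1 x2] [p1 p2] [q1 q2] /= E1 E2.
    congr pair; [change (x1 = (1 - t) * p1 + t * q1) | change (x2 = (1 - t) * p2 + t * q2)]; lra.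
  have [t0|t0] := ltP t 0.
    exists d; split.
      rewrite (_ : dotp d (p - x) = - dotp d (x - p)); last by rewrite /dotp /=; ring.
      by rewrite oppr_gt0; move: t0; rewrite /t pmulr_llt0 ?invr_gt0.
    rewrite (_ : dotp d (q - x) = (d.1 ^+ 2 + d.2 ^+ 2) - dotp d (x - p)).
      by rewrite subr_gt0 (lt_trans _ D0) //; move: t0; rewrite /t pmulr_llt0 ?invr_gt0.
    by rewrite /dotp /d /=; ring.
  have [t1|t1] := ltP 1 t.
    have t1' : d.1 ^+ 2 + d.2 ^+ 2 < dotp d (x - p).
      by move: t1; rewrite /t ltr_pdivlMr // mul1r.
    exists (- d); split.
      rewrite (_ : dotp (- d) (p - x) = dotp d (x - p)) ?(lt_trans D0) //.
      by rewrite /dotp /=; ring.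
    rewrite (_ : dotp (- d) (q - x) = dotp d (x - p) - (d.1 ^+ 2 + d.2 ^+ 2)).
      by rewrite subr_gt0.
    by rewrite /dotp /d /=; ring.
  by case: npq; exists t; rewrite -?xE //= in_itv /= t0 t1.
- exists (- n); split; rewrite (_ : dotp (- n) _ = - dotp n (p - x)) ?oppr_gt0 //.
    by rewrite /dotp /=; ring.
  by rewrite np /dotp /=; ring.
- by exists n; split; rewrite -?np.
Qed.

Lemma winding_locally_constant x s : ~ polygon_boundary s x ->
  \forall y \near x, winding y s = winding x s.
Proof.
move=> nBx.
have sep (k : 'I_(size s)) : exists u, 0 < dotp u (s`_k - x) /\
    0 < dotp u (s`_(k.+1 %% size s) - x).
  by apply: segment_separation => h; apply: nBx; exists k => //=.
pose good (k : 'I_(size s)) y := exists u,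
    [/\ 0 < dotp u (s`_k - x), 0 < dotp u (s`_(k.+1 %% size s) - x),
        0 < dotp u (s`_k - y) & 0 < dotp u (s`_(k.+1 %% size s) - y)].
have near_good : \forall y \near x, forall k, good k y.
  apply: (@filter_forall _ _ good (nbhs x) (nbhs_filter x)) => k; have [u [h1 h2]] := sep k.
  by near=> y; exists u; split => //; near: y; exact: near_dotp.
near=> y; apply/eqP; rewrite -subr_eq0.
(* When the viewpoint moves from [x] to [y], the crossing number of a side changes by the difference
   of [phi] at its ends. As [phi] depends neither on the side nor on its half-plane, the changes
   cancel around the polygon. *)
pose phi p := crossing 0 (p - x) (p - y).
suff -> : winding y s - winding x s =
    \sum_(k < size s) phi s`_(k.+1 %% size s) - \sum_(k < size s) phi s`_k.
  by rewrite sum_cyclic subrr.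
rewrite /winding -!sumrB; apply: eq_bigr => k _.
have [u [h1 h2 h3 h4]] : good k y by move: k; near: y.
rewrite !(crossing_translate _ s`_k) /phi !(@crossing_halfplane R 0 u) ?subr0 //.
by case: ifP => // _; ring.
Unshelve. all: by end_near. Qed.

Lemma winding_connected (D : set (R * R)) s x y : connected D ->
  D `<=` ~` polygon_boundary s -> D x -> D y -> winding y s = winding x s.
Proof.
move=> cD DB Dx Dy.
pose W (b : bool) := [set z | (winding z s == winding x s) = b].
have DW b z : D z -> W b z <-> (W b)° z.
  move=> Dz; split; last exact: interior_subset.
  rewrite /W /interior /= => <-; apply: filterS (winding_locally_constant (DB z Dz)).
  by move=> z' E; rewrite /= E.
have DWT : D `&` W true = D.
  apply: cD.
  - by exists x; split=> //; exact: eqxx.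
  - exists (W true)°; first exact: open_interior.
    by apply/seteqP; split=> z [Dz Wz]; split=> //; apply/(DW true z Dz).
  - exists (~` (W false)°); first exact/open_closedC/open_interior.
    apply/seteqP; split=> z [Dz Wz]; split=> //.
      by move/(DW false z Dz); rewrite /W /= Wz.
    by rewrite /W /=; apply/negP => /negP/negbTE h; apply: Wz; apply/(DW false z Dz).
by have : (D `&` W true) y by [rewrite DWT]; case=> _ /eqP.
Qed.

End Polygons.

(** * Placed polygons *)

Section Placement.
Variable R : realType.
Implicit Types (p q r u x y : R * R) (s : seq (R * R)).

(** Seen from a point outside a box around the vertices, the whole polygon lies in a half-plane and
    the winding number is 0; a nonzero constant value confines [D] to the box. *)
Lemma winding_bounded (D : set (R * R)) s x : connected D ->
  D `<=` ~` polygon_boundary s -> D x -> winding x s != 0 ->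
  exists M, forall y, D y -> `|y.1| <= M /\ `|y.2| <= M.
Proof.
move=> cD DB Dx wx; pose M := \sum_(k < size s) (`|(s`_k).1| + `|(s`_k).2|).
have sM k : (k < size s)%N -> `|(s`_k).1| <= M /\ `|(s`_k).2| <= M.
  move=> ks; have : `|(s`_k).1| + `|(s`_k).2| <= M.
    rewrite /M (bigD1 (Ordinal ks)) //= -[leLHS]addr0 lerD2l.
    by apply: sumr_ge0 => i _; rewrite addr_ge0.
  by have := normr_ge0 (s`_k).1; have := normr_ge0 (s`_k).2; lra.
exists M => y Dy.
have wy : winding y s != 0 by rewrite (winding_connected cD DB Dx Dy).
have out u : (forall k, (k < size s)%N -> 0 < dotp u (s`_k - y)) -> False.
  by move=> hu; move: wy; rewrite (winding_halfplane hu) eqxx.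
split; rewrite leNgt; apply/negP => yM.
  have [y0|y0] := leP 0 y.1.
    apply: (out (-1, 0)) => k /sM[]; rewrite ger0_norm // in yM.
    by rewrite /dotp /= ler_norml => /andP[]; lra.
  apply: (out (1, 0)) => k /sM[]; rewrite ltr0_norm // in yM.
  by rewrite /dotp /= ler_norml => /andP[]; lra.
have [y0|y0] := leP 0 y.2.
  apply: (out (0, -1)) => k /sM[_]; rewrite ger0_norm // in yM.
  by rewrite /dotp /= ler_norml => /andP[]; lra.
apply: (out (0, 1)) => k /sM[_]; rewrite ltr0_norm // in yM.
by rewrite /dotp /= ler_norml => /andP[]; lra.
Qed.

(** * Rotations followed by translations, acting on polygons *)

Definition place (t : (R * R) * 'Z_12) x : R * R := t.1 + cmul (dir R t.2) x.
Definition unplace (t : (R * R) * 'Z_12) x : R * R :=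
  cmul (dir R (- t.2)) (x - t.1).

Lemma placeK t : cancel (place t) (unplace t).
Proof.
move=> x; rewrite /unplace /place addrC addKr -cmulA -dirD addrC subrr dir0.
by apply: pair_eqP => /=; ring.
Qed.

Lemma unplaceK t : cancel (unplace t) (place t).
Proof.
move=> x; rewrite /unplace /place -cmulA -dirD subrr dir0.
by apply: pair_eqP => /=; ring.
Qed.

Lemma signed_area2_place t p q r :
  signed_area2 (place t p) (place t q) (place t r) = signed_area2 p q r.
Proof.
rewrite -[RHS]mul1r -(dir_norm R t.2) /signed_area2 /place /cmul /=; ring.
Qed.

Lemma place_isometry t : euclidean_isometry (place t).
Proof.
move=> p q; congr Num.sqrt; rewrite -[RHS]mul1r -(dir_norm R t.2).
by rewrite /place /cmul /=; ring.
Qed.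

Lemma place_orientation t : orientation_preserving (place t).
Proof. by move=> p q r; rewrite signed_area2_place. Qed.

Lemma place_segment t p q x :
  line_segment (place t p) (place t q) (place t x) <-> line_segment p q x.
Proof.
have E a : (1 - a) *: place t p + a *: place t q = place t ((1 - a) *: p + a *: q).
  by apply: pair_eqP; rewrite /place /cmul /= /GRing.scale /=; ring.
split=> -[a a01]; rewrite ?E => ax; exists a => //; last by rewrite E ax.
exact: (can_inj (placeK t)).
Qed.

Lemma place_boundary t s x :
  polygon_boundary (map (place t) s) (place t x) <-> polygon_boundary s x.
Proof.
have mods k : (k < size s)%N -> (k.+1 %% size s < size s)%N.
  by move=> ks; rewrite ltn_mod (leq_ltn_trans _ ks).
rewrite /polygon_boundary size_map; split=> -[k /= ks h]; exists k => //.
  by move: h; rewrite !(nth_map 0) ?mods // place_segment.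
by rewrite !(nth_map 0) ?mods // place_segment.
Qed.

Lemma continuous_place t : continuous (place t).
Proof.
have lin (a b c : R) : continuous (fun x : R * R => a + (b * x.1 + c * x.2) : R).
  move=> x; apply: cvgD; first exact: cvg_cst.
  by apply: cvgD; apply: cvgMl_tmp; [exact: cvg_fst | exact: cvg_snd].
have -> : place t = fun x => (t.1.1 + ((dir R t.2).1 * x.1 + - (dir R t.2).2 * x.2),
    t.1.2 + ((dir R t.2).2 * x.1 + (dir R t.2).1 * x.2)).
  by apply: funext => x; apply: pair_eqP; rewrite /place /cmul /=; ring.
by move=> x; apply: (cvg_pair (lin _ _ _ x) (lin _ _ _ x)).
Qed.

Lemma bounded_norm (C : set (R * R)) M :
  (forall z, C z -> `|z.1| <= M /\ `|z.2| <= M) -> bounded_set C.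
Proof.
move=> CM; rewrite /= /bounded_near; near=> K => z Cz; have [z1 z2] := CM z Cz.
have MK : M <= K by near: K; apply: nbhs_pinfty_ge; exact: num_real.
by rewrite /= prod_normE ge_max !(le_trans _ MK).
Unshelve. all: by end_near. Qed.

(** The component of the preimage of [x] is carried over by [place t], bounded there by the winding
    number, and carried back. *)
Lemma place_closed_polygon t s x : winding x (map (place t) s) != 0 ->
  (place t @` closed_polygon s) x.
Proof.
move=> wx; exists (unplace t x); last exact: unplaceK.
have [By|nBy] := pselect (polygon_boundary s (unplace t x)); [by left | right].
split=> //; set C := connected_component _ _.
have CB : C `<=` ~` polygon_boundary s by exact: connected_component_sub.
have cfC : connected (place t @` C).
  apply: connected_continuous_connected; first exact: component_connected.
  by apply: continuous_subspaceT => ?; exact: continuous_place.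
have fCB : place t @` C `<=` ~` polygon_boundary (map (place t) s).
  by move=> _ [z Cz <-]; rewrite /= place_boundary; exact: CB.
have fCx : (place t @` C) x.
  by exists (unplace t x); [exact: connected_component_refl | exact: unplaceK].
have [M hM] := winding_bounded cfC fCB fCx wx.
pose N := `|t.1.1| + `|t.1.2|.
have dir1k k : `|(dir R k).1| <= 1 /\ `|(dir R k).2| <= 1.
  by split; rewrite -(@expr_le1 _ 2) // real_normK ?num_real // -(dir_norm R k)
    ?lerDl ?lerDr sqr_ge0.
apply: (@bounded_norm _ (2 * (M + N))) => z Cz.
have [h1 h2] : `|(place t z).1| <= M /\ `|(place t z).2| <= M by apply: hM; exists z.
have N1 : `|(place t z - t.1).1| <= M + N.
  by rewrite (le_trans (ler_normB _ _)) // lerD // lerDl.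
have N2 : `|(place t z - t.1).2| <= M + N.
  by rewrite (le_trans (ler_normB _ _)) // lerD // lerDr.
have [d1 d2] := dir1k (- t.2); rewrite -(placeK t z) /unplace.
move: (dir R _) (place t z - t.1) d1 d2 N1 N2 => [c e] [a b] /= d1 d2 N1 N2.
have le1 (u v : R) : `|u| <= 1 -> `|v| <= M + N -> `|u * v| <= M + N.
  by move=> u1 v1; rewrite normrM -[leRHS]mul1r ler_pM.
by split; [rewrite (le_trans (ler_normB _ _)) | rewrite (le_trans (ler_normD _ _))];
  rewrite // mulr_natl mulr2n lerD ?le1.
Qed.

Lemma ray_unbounded (A : set (R * R)) x u : u != 0 ->
  (forall a, 0 <= a -> A (x + a *: u)) -> ~ bounded_set (connected_component A x).
Proof.
move=> u0 Aray; rewrite /= /bounded_near => bC.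
have [M hM] := filter_ex bC.
pose ray := (fun a : R => x + a *: u) @` `[0, +oo[.
have cray : connected ray.
  apply: connected_continuous_connected.
    exact/connected_intervalP/interval_is_interval.
  apply: continuous_subspaceT => a; apply: cvgD; first exact: cvg_cst.
  exact: cvgZr_tmp.
have rC : ray `<=` connected_component A x.
  apply: connected_component_max => //.
    by exists 0; rewrite ?scale0r ?addr0 //= in_itv /= lexx.
  by move=> _ [a a0 <-]; apply: Aray; move: a0; rewrite /= in_itv /= andbT.
have nu : 0 < `|u| by rewrite normr_gt0.
pose a := (`|M| + `|x| + 1) / `|u|.
have a0 : 0 <= a by rewrite divr_ge0 // ?addr_ge0.
have : `|x + a *: u| <= M.
  by apply: hM; apply: rC; exists a => //=; rewrite in_itv /= a0.
apply/negP; rewrite -ltNge.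
have : `|a *: u| <= `|x + a *: u| + `|x|.
  by have := ler_normB (x + a *: u) x; rewrite addrAC subrr add0r.
rewrite normrZ ger0_norm // divfK ?gt_eqF //.
by have := ler_norm M; lra.
Qed.

End Placement.

(** * The shape of the spectre *)

(* [zdet v w = (a, b)] when four times the determinant of [v] and [w] is
   [a + b * sqrt 3]. *)
Definition zdet (v w : vec) : Z * Z :=
  let: (a0, a1, a2, a3) := v in let: (b0, b1, b2, b3) := w in
  let x := 2%BZ * a0 + a2 in let y := a1 + 2%BZ * a3 in
  let x' := 2%BZ * b0 + b2 in let y' := b1 + 2%BZ * b3 in
  (x * y' + 3%BZ * (a1 * b2) - (y * x' + 3%BZ * (a2 * b1)),
   x * b2 + a1 * y' - (y * b1 + a2 * x')).

Definition zpos (z : Z * Z) : bool :=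
  0 < 615%BZ * z.1 + (if (0 <=? z.2)%BZ then 1065%BZ else 1066%BZ) * z.2.

Definition spectre_vec (i : nat) : vec :=
  wdisp zunit (take i (spectre_word 0)).

Section SpectreShape.
Variable R : realType.
Implicit Types (p q r u x : R * R).

Local Notation dir := (@dir R).

Definition det u v : R := u.1 * v.2 - u.2 * v.1.

Lemma det_emb v w : det (emb R v) (emb R w) =
  (ZtoR R (zdet v w).1 + ZtoR R (zdet v w).2 * Num.sqrt 3) / 4.
Proof.
case: v w => [[[a0 a1] a2] a3] [[[b0 b1] b2] b3].
have -> : (zdet (a0, a1, a2, a3) (b0, b1, b2, b3)).1 =
  (2%BZ * a0 + a2) * (b1 + 2%BZ * b3) + 3%BZ * (a1 * b2) -
  ((a1 + 2%BZ * a3) * (2%BZ * b0 + b2) + 3%BZ * (a2 * b1)) by [].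
have -> : (zdet (a0, a1, a2, a3) (b0, b1, b2, b3)).2 =
  (2%BZ * a0 + a2) * b2 + a1 * (b1 + 2%BZ * b3) -
  ((a1 + 2%BZ * a3) * b1 + a2 * (2%BZ * b0 + b2)) by [].
rewrite !(ZtoRD, ZtoRN, ZtoRM) (_ : ZtoR R 3%BZ = 3) // (_ : ZtoR R 2%BZ = 2) //.
have := sqr_sqrt3 R; rewrite /det !embE /=; set s := Num.sqrt 3 => s3.
apply/eqP; rewrite -subr_eq0; apply/eqP.
transitivity ((ZtoR R a1 * ZtoR R b2 - ZtoR R a2 * ZtoR R b1) / 4 * (s * s - 3)).
  by field.
by rewrite s3 subrr mulr0.
Qed.

Lemma zpos_gt0 z : zpos z -> 0 < ZtoR R z.1 + ZtoR R z.2 * Num.sqrt 3.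
Proof.
case: z => a b; rewrite /zpos [_.1]/= [_.2]/= => h.
have : 0 < ZtoR R (615%BZ * a + (if (0 <=? b)%BZ then 1065%BZ else 1066%BZ) * b).
  by rewrite (_ : 0 = ZtoR R 0) // lt_neqAle ler_ZtoR eq_le !ler_ZtoR -eq_le -lt_neqAle.
rewrite ZtoRD !ZtoRM (_ : ZtoR R 615%BZ = 615) //.
have /andP[s1 s2] := sqrt3_bounds R.
case: Z.leb_spec => b0.
  have b0' : 0 <= ZtoR R b by rewrite (_ : 0 = ZtoR R 0) // ler_ZtoR; lia.
  rewrite (_ : ZtoR R 1065%BZ = 1065) //.
  have : 0 <= ZtoR R b * (Num.sqrt 3 - 71 / 41) by rewrite mulr_ge0 // subr_ge0.
  lra.
have b0' : ZtoR R b <= 0 by rewrite (_ : 0 = ZtoR R 0) // ler_ZtoR; lia.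
rewrite (_ : ZtoR R 1066%BZ = 1066) //.
have : 0 <= ZtoR R b * (Num.sqrt 3 - 26 / 15) by rewrite mulr_le0 // subr_le0.
lra.
Qed.

Lemma det_gt0 v w : zpos (zdet v w) -> 0 < det (emb R v) (emb R w).
Proof. by move=> /zpos_gt0 h; rewrite det_emb divr_gt0. Qed.

Lemma det_le0 v w : (zdet v w == 0) || zpos (- zdet v w) ->
  det (emb R v) (emb R w) <= 0.
Proof.
rewrite det_emb pmulr_lle0 ?invr_gt0 // => /orP[/eqP ->|].
  by rewrite [_.1]/= [_.2]/= (_ : ZtoR R 0 = 0) // mul0r addr0.
move/zpos_gt0; case: (zdet v w) => a b; by rewrite [_.1]/= [_.2]/= !ZtoRN; lra.
Qed.

Definition vert (i : nat) : R * R := emb R (spectre_vec i).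

(** The Spectre runs clockwise, so [edge] is positive on the outer side of a side and the triangles
    are cut out by nonpositive values. *)
Definition edge (i j : nat) x : R := signed_area2 (vert i) (vert j) x.

Lemma edgeN i j x : edge j i x = - edge i j x.
Proof. exact: area_opp. Qed.

Lemma edge_from i j x : edge i j x =
  det (emb R (spectre_vec j - spectre_vec i)) (x - vert i).
Proof. by rewrite embB. Qed.

Lemma edge_to i j x : edge i j x =
  det (emb R (spectre_vec j - spectre_vec i)) (x - vert j).
Proof. by rewrite embB /edge /det /signed_area2 /vert /=; ring. Qed.

Definition dvec (e : nat * nat) : vec := spectre_vec e.2 - spectre_vec e.1.

(* Three lines through the vertex [k] whose directions positively span the plane. *)
Definition spanning (k : nat) (a b c : nat * nat) : bool :=
  [&& (k == a.1) || (k == a.2), (k == b.1) || (k == b.2),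
      (k == c.1) || (k == c.2), zpos (zdet (dvec a) (dvec b)),
      zpos (zdet (dvec b) (dvec c)) & zpos (zdet (dvec c) (dvec a))].

(** A combination of the three edge functions with positive coefficients, the mutual determinants of
    the directions, vanishes identically. *)
Lemma spanning_false k a b c x : spanning k a b c ->
  0 < edge a.1 a.2 x -> 0 <= edge b.1 b.2 x -> 0 <= edge c.1 c.2 x -> False.
Proof.
have edgeE (e : nat * nat) : (k == e.1) || (k == e.2) ->
    edge e.1 e.2 x = det (emb R (dvec e)) (x - vert k).
  by case/orP => /eqP ->; [exact: edge_from | exact: edge_to].
case/and3P => ka kb /and4P[kc /det_gt0 ab /det_gt0 bc /det_gt0 ca].
rewrite !edgeE //; move: (emb R (dvec a)) (emb R (dvec b)) (emb R (dvec c)) (x - _) ab bc ca.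
move=> u v w y uv vw wu yu yv yw.
have : det v w * det u y + det w u * det v y + det u v * det w y = 0.
  by rewrite /det; ring.
have : 0 < det v w * det u y by rewrite mulr_gt0.
have : 0 <= det w u * det v y by rewrite mulr_ge0 // ltW.
have : 0 <= det u v * det w y by rewrite mulr_ge0 // ltW.
by lra.
Qed.

Definition in_triangle (t : nat * nat * nat) x : Prop :=
  [/\ edge t.1.1 t.1.2 x <= 0, edge t.1.2 t.2 x <= 0 & edge t.2 t.1.1 x <= 0].

Definition triangles : seq (nat * nat * nat) :=
  [:: (1, 2, 3); (1, 3, 4); (4, 5, 6); (4, 6, 7); (4, 7, 8); (10, 11, 12);
      (10, 12, 13); (13, 0, 1); (13, 1, 4); (13, 4, 8); (13, 8, 9); (13, 9, 10)]%N.

(* Half-planes and wedges bounded by sides of the Spectre, in which a ray leads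
   from each point to infinity without meeting the boundary. The half-plane
   [edge i j > 0] is listed as [((i, j), (i, j))]. *)
Definition escapes : seq ((nat * nat) * (nat * nat)) :=
  [:: ((2, 3), (2, 3)); ((5, 6), (5, 6)); ((6, 7), (6, 7)); ((9, 10), (9, 10));
      ((11, 12), (11, 12)); ((0, 1), (1, 2)); ((3, 4), (4, 5)); ((7, 8), (8, 9));
      ((12, 13), (13, 0))]%N.

Lemma flat_vertex :
  spectre_vec 11 - spectre_vec 10 = spectre_vec 10 - spectre_vec 9.
Proof. by apply/eqP; vm_compute. Qed.

(** The diagonals 4-8, 1-4 and 10-13 cut three caps off a core, which is fanned from vertex 13. The
    wedges sit at the reflex vertices 1, 4, 8 and 13: beyond one side of a wedge, a point that does
    not escape is not beyond the other, and the position relative to a diagonal then contradicts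
    [spanning_false]. *)
Lemma escape_or_triangle x :
  (exists2 e, e \in escapes & 0 < edge e.1.1 e.1.2 x /\ 0 < edge e.2.1 e.2.2 x) \/
  (exists2 t, t \in triangles & in_triangle t x).
Proof.
case: (pselect (exists2 e, e \in escapes &
  0 < edge e.1.1 e.1.2 x /\ 0 < edge e.2.1 e.2.2 x)) => [|no_esc]; [by left | right].
have plane i j : ((i, j), (i, j)) \in escapes -> edge i j x <= 0.
  by move=> ij; rewrite leNgt; apply/negP => h; apply: no_esc; exists ((i, j), (i, j)).
have wedge i j i' j' : ((i, j), (i', j')) \in escapes ->
    0 < edge i j x -> edge i' j' x <= 0.
  move=> ij h; rewrite leNgt; apply/negP => h'; apply: no_esc.
  by exists ((i, j), (i', j')).
have wedge' i j i' j' : ((i, j), (i', j')) \in escapes ->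
    0 < edge i' j' x -> edge i j x <= 0.
  move=> ij h; rewrite leNgt; apply/negP => h'; apply: no_esc.
  by exists ((i, j), (i', j')).
have flip i j : edge i j x <= 0 -> 0 <= edge j i x by rewrite (edgeN i j) oppr_ge0.
have flip' i j : 0 <= edge i j x -> edge j i x <= 0 by rewrite (edgeN i j) oppr_le0.
have tri a b c : (a, b, c) \in triangles -> edge a b x <= 0 -> edge b c x <= 0 ->
    edge c a x <= 0 -> exists2 t, t \in triangles & in_triangle t x.
  by move=> abc h1 h2 h3; exists (a, b, c).
have e2 := plane 2%N 3%N isT; have e5 := plane 5%N 6%N isT.
have e6 := plane 6%N 7%N isT; have e9 := plane 9%N 10%N isT.
have e11 := plane 11%N 12%N isT.
(* The angle at vertex 10 is flat, so this is the line of the side 9-10. *)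
have e10 : edge 10 11 x <= 0.
  by rewrite edge_from flat_vertex -edge_to.
have [c2|c2] := ltP 0 (edge 4 8 x).
  have e4 : edge 4 5 x <= 0.
    rewrite leNgt; apply/negP => h; have /flip h' := wedge' 3%N 4%N 4%N 5%N isT h.
    by apply: (@spanning_false 4 (4, 5) (4, 3) (4, 8) x _ h h' (ltW c2)); vm_compute.
  have e7 : edge 7 8 x <= 0.
    rewrite leNgt; apply/negP => h; have /flip h' := wedge 7%N 8%N 8%N 9%N isT h.
    by apply: (@spanning_false 8 (7, 8) (4, 8) (9, 8) x _ h (ltW c2) h'); vm_compute.
  have [d46|/ltW d46] := leP 0 (edge 4 6 x).
    exact: (tri 4 5 6 isT e4 e5 (flip' _ _ d46))%N.
  have [d47|/ltW d47] := leP 0 (edge 4 7 x).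
    exact: (tri 4 6 7 isT d46 e6 (flip' _ _ d47))%N.
  exact: (tri 4 7 8 isT d47 e7 (flip' _ _ (ltW c2)))%N.
have [c1|c1] := ltP 0 (edge 1 4 x).
  have e1 : edge 1 2 x <= 0.
    rewrite leNgt; apply/negP => h; have /flip h' := wedge' 0%N 1%N 1%N 2%N isT h.
    by apply: (@spanning_false 1 (1, 2) (1, 0) (1, 4) x _ h h' (ltW c1)); vm_compute.
  have e3 : edge 3 4 x <= 0.
    rewrite leNgt; apply/negP => h; have /flip h' := wedge 3%N 4%N 4%N 5%N isT h.
    by apply: (@spanning_false 4 (3, 4) (8, 4) (5, 4) x _ h (flip _ _ c2) h'); vm_compute.
  have [d13|/ltW d13] := leP 0 (edge 1 3 x).
    exact: (tri 1 2 3 isT e1 e2 (flip' _ _ d13))%N.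
  exact: (tri 1 3 4 isT d13 e3 (flip' _ _ (ltW c1)))%N.
have [c3|c3] := ltP 0 (edge 10 13 x).
  have e12 : edge 12 13 x <= 0.
    rewrite leNgt; apply/negP => h; have /flip h' := wedge 12%N 13%N 13%N 0%N isT h.
    by apply: (@spanning_false 13 (12, 13) (10, 13) (0, 13) x _ h (ltW c3) h'); vm_compute.
  have [d|/ltW d] := leP 0 (edge 10 12 x).
    exact: (tri 10 11 12 isT e10 e11 (flip' _ _ d))%N.
  exact: (tri 10 12 13 isT d e12 (flip' _ _ (ltW c3)))%N.
have e0 : edge 0 1 x <= 0.
  rewrite leNgt; apply/negP => h; have /flip h' := wedge 0%N 1%N 1%N 2%N isT h.
  by apply: (@spanning_false 1 (0, 1) (4, 1) (2, 1) x _ h (flip _ _ c1) h'); vm_compute.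
have e8 : edge 8 9 x <= 0.
  rewrite leNgt; apply/negP => h; have /flip h' := wedge' 7%N 8%N 8%N 9%N isT h.
  by apply: (@spanning_false 8 (8, 9) (8, 7) (8, 4) x _ h h' (flip _ _ c2)); vm_compute.
have e13 : edge 13 0 x <= 0.
  rewrite leNgt; apply/negP => h; have /flip h' := wedge' 12%N 13%N 13%N 0%N isT h.
  by apply: (@spanning_false 13 (13, 0) (13, 12) (13, 10) x _ h h' (flip _ _ c3)); vm_compute.
have [d1|/ltW d1] := leP 0 (edge 13 1 x).
  exact: (tri 13 0 1 isT e13 e0 (flip' _ _ d1))%N.
have [d4|/ltW d4] := leP 0 (edge 13 4 x).
  exact: (tri 13 1 4 isT d1 c1 (flip' _ _ d4))%N.
have [d8|/ltW d8] := leP 0 (edge 13 8 x).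
  exact: (tri 13 4 8 isT d4 c2 (flip' _ _ d8))%N.
have [d9|/ltW d9] := leP 0 (edge 13 9 x).
  exact: (tri 13 8 9 isT d8 e8 (flip' _ _ d9))%N.
exact: (tri 13 9 10 isT d9 e9 c3)%N.
Qed.

End SpectreShape.

(** * Winding numbers of placed spectres *)

Section SpectreTile.
Variable R : realType.
Implicit Types (p q r u x y : R * R) (t : (R * R) * 'Z_12).

Local Notation dir := (@dir R).
Local Notation vert := (@vert R).
Local Notation edge := (@edge R).
Local Notation vertices := (mkseq (spectre_vertex R) 14).

Lemma wdisp_sum w : wdisp dir w = \sum_(d <- w) dir d.
Proof. by elim: w => [|d w IH]; rewrite ?big_nil // big_cons -IH. Qed.

Lemma spectre_vertexE i : spectre_vertex R i = vert i.
Proof.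
rewrite /vert /spectre_vec -wdisp_emb wdisp_sum /spectre_word -map_take big_map.
have -> : spectre_vertex R i =
    \sum_(d <- take i (map (muln 30) [:: 0; 2; 11; 9; 0; 10; 7; 5; 8; 6; 6; 4; 1; 3]%N))
      unit_step R d by [].
rewrite -map_take big_map; apply: eq_bigr => d _.
by rewrite addr0 -unit_step_mod12.
Qed.

Lemma place_vert q (k : 'Z_12) (i : nat) :
  place (q, k) (vert i) = q + wdisp dir (take i (spectre_word k)).
Proof.
rewrite /place /vert /spectre_vec -wdisp_emb [_.1]/= [_.2]/=; congr (_ + _).
rewrite /spectre_word -!map_take; elim: (take i _) => [|d w IH].
  by apply: pair_eqP; rewrite /= /cmul /=; ring.
change (cmul (dir k) (dir (inZp d + 0) + wdisp dir [seq inZp d0 + 0 | d0 <- w]) =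
  dir (inZp d + k) + wdisp dir [seq inZp d0 + k | d0 <- w]).
by rewrite cmulDr IH addr0 dirD cmulC.
Qed.

Lemma winding_word x q w : wdisp dir w = 0 ->
  winding x (mkseq (fun i => q + wdisp dir (take i w)) (size w)) =
  wsum dir (step_crossing x) q w.
Proof.
move=> w0; rewrite /winding size_mkseq.
transitivity (\sum_(i < size w) crossing x (q + wdisp dir (take i w))
    (q + wdisp dir (take i.+1 w))).
  apply: eq_bigr => i _; rewrite nth_mkseq ?ltn_ord // nth_mkseq; last first.
    by rewrite ltn_mod (leq_ltn_trans _ (ltn_ord i)).
  have := ltn_ord i; rewrite -ltnS => /ltnSE; rewrite leq_eqVlt => /orP[/eqP ->|h].
    by rewrite modnn take0 take_size w0.
  by rewrite modn_small.
elim: w q {w0} => [|d w IH] q; first by rewrite big_ord0.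
rewrite big_ord_recl.
change (wsum dir (step_crossing x) q (d :: w)) with
  (step_crossing x q d + wsum dir (step_crossing x) (q + dir d) w).
rewrite -IH; congr (_ + _).
  by rewrite /step_crossing /= take0 /= !addr0.
by apply: eq_bigr => i _; rewrite /= !addrA.
Qed.

Lemma winding_place x q (k : 'Z_12) : winding x (map (place (q, k)) vertices) =
  wsum dir (step_crossing x) q (spectre_word k).
Proof.
rewrite -winding_word; last exact: wdisp_spectre (@dir_dinv R) k.
rewrite -map_comp; congr winding; apply: eq_map => i.
by rewrite /= spectre_vertexE place_vert.
Qed.

Definition triangle_area (s : nat * nat * nat) : R :=
  signed_area2 (vert s.2) (vert s.1.2) (vert s.1.1).

Lemma triangle_area_gt0 s : s \in triangles -> 0 < triangle_area s.
Proof.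
have : all (fun s => zpos (zdet (dvec (s.2, s.1.2)) (dvec (s.2, s.1.1)))) triangles.
  by vm_compute.
by move=> /allP h /h /(det_gt0 R); rewrite /dvec !embB.
Qed.

(** Each of the 11 diagonals occurs once in either direction and cancels; the rewriting gives all
    sides and diagonals a common orientation. *)
Lemma polygon_triangles (c : nat -> nat -> int) : (forall i j, c j i = - c i j) ->
  - (\sum_(k < 14) c k (k.+1 %% 14)%N) =
  \sum_(s <- triangles) (c s.2 s.1.2 + c s.1.2 s.1.1 + c s.1.1 s.2).
Proof.
move=> cN; rewrite -(big_mkord xpredT (fun k => c k (k.+1 %% 14)%N)).
rewrite /index_iota subn0 /= !big_cons !big_nil modnn !(@modn_small _ 14) //.
rewrite (cN 0 1)%N (cN 0 13)%N (cN 1 2)%N (cN 1 3)%N (cN 1 4)%N (cN 1 13)%N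
  (cN 2 3)%N (cN 3 4)%N (cN 4 5)%N (cN 4 6)%N (cN 4 7)%N (cN 4 8)%N
  (cN 4 13)%N (cN 5 6)%N (cN 6 7)%N (cN 7 8)%N (cN 8 9)%N (cN 8 13)%N
  (cN 9 10)%N (cN 9 13)%N (cN 10 11)%N (cN 10 12)%N (cN 10 13)%N (cN 11 12)%N
  (cN 12 13)%N.
ring.
Qed.

Lemma winding_triangles x t : - winding x (map (place t) vertices) =
  \sum_(s <- triangles) tri_crossing x (place t (vert s.2)) (place t (vert s.1.2))
    (place t (vert s.1.1)).
Proof.
have -> : map (place t) vertices = mkseq (fun i => place t (vert i)) 14.
  by rewrite /mkseq -map_comp; apply: eq_map => i; rewrite /= spectre_vertexE.
rewrite /winding size_mkseq.
rewrite (eq_bigr (fun k : 'I_14 => crossing x (place t (vert k))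
    (place t (vert (k.+1 %% 14))))); last first.
  by move=> k _; rewrite !nth_mkseq // ltn_mod.
exact: (polygon_triangles (c := fun i j => crossing x (place t (vert i)) (place t (vert j)))
  (fun i j => crossingN _ _ _)).
Qed.

Lemma winding_le0 x t : winding x (map (place t) vertices) <= 0.
Proof.
rewrite -oppr_ge0 winding_triangles big_seq sumr_ge0 // => s /triangle_area_gt0 h.
by apply: tri_crossing_ge0; rewrite signed_area2_place ltW.
Qed.

Lemma winding_lt0 x t s : s \in triangles ->
  edge s.1.1 s.1.2 (unplace t x) < 0 -> edge s.1.2 s.2 (unplace t x) < 0 ->
  edge s.2 s.1.1 (unplace t x) < 0 -> winding x (map (place t) vertices) < 0.
Proof.
move=> st h1 h2 h3; rewrite -oppr_gt0 winding_triangles (big_rem s) //.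
have edge_place i j : edge i j (unplace t x) < 0 ->
    0 < signed_area2 (place t (vert j)) (place t (vert i)) x.
  by rewrite -oppr_gt0 -edgeN /edge -(signed_area2_place t) unplaceK.
rewrite ltr_wpDr ?tri_crossing_gt0 ?edge_place //.
rewrite big_seq sumr_ge0 // => s' /mem_rem/triangle_area_gt0 h.
by apply: tri_crossing_ge0; rewrite signed_area2_place ltW.
Qed.

(** Both ends of the side are behind the same bounding line of the region, so the whole side is, and
    it misses the region. *)
Definition side_escaped (e : (nat * nat) * (nat * nat)) (k : nat) : bool :=
  let behind (f : nat * nat) j := let z := zdet (dvec f) (dvec (f.1, j)) in
    (z == 0) || zpos (- z) in
  let k' := (k.+1 %% 14)%N in
  behind e.1 k && behind e.1 k' || behind e.2 k && behind e.2 k'.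

Lemma sides_escaped e k : e \in escapes -> (k < 14)%N -> side_escaped e k.
Proof.
move=> eE k14.
have /allP/(_ e eE)/allP : all (fun e => all (side_escaped e) (iota 0 14)) escapes.
  by vm_compute.
by apply; rewrite mem_iota.
Qed.

Lemma edge_affine i j a b p q : a + b = 1 ->
  edge i j (a *: p + b *: q) = a * edge i j p + b * edge i j q.
Proof.
move=> ab; rewrite /edge; move: (vert i) (vert j) => [v1 v2] [w1 w2].
have -> : b = 1 - a by rewrite -ab addrC addKr.
by case: p q => [p1 p2] [q1 q2]; rewrite /signed_area2 /= /GRing.scale /=; ring.
Qed.

Lemma escape_boundary e y : e \in escapes ->
  0 < edge e.1.1 e.1.2 y -> 0 < edge e.2.1 e.2.2 y -> ~ polygon_boundary vertices y.
Proof.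
move=> eE h1 h2 [k k14' [a a01 yE]].
have k14 : (k < 14)%N by [].
move: a01; rewrite /= in_itv /= => /andP[a0 a1].
have k'14 : (k.+1 %% 14 < 14)%N by rewrite ltn_mod.
rewrite size_mkseq !nth_mkseq // !spectre_vertexE in yE.
have b0 : 0 <= 1 - a by rewrite subr_ge0.
have behind (f : nat * nat) j : (zdet (dvec f) (dvec (f.1, j)) == 0) ||
    zpos (- zdet (dvec f) (dvec (f.1, j))) -> edge f.1 f.2 (vert j) <= 0.
  by move=> /(det_le0 R); rewrite edge_from -embB.
have side (f : nat * nat) : 0 < edge f.1 f.2 y ->
    edge f.1 f.2 (vert k) <= 0 -> edge f.1 f.2 (vert (k.+1 %% 14)) <= 0 -> False.
  move=> fy fk fk'; move: fy; rewrite -yE edge_affine ?subrK //.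
  by rewrite ltNge -[leRHS]addr0 lerD ?mulr_ge0_le0.
have /orP[] := sides_escaped eE k14; move=> /andP[/behind hk /behind hk'].
  exact: side h1 hk hk'.
exact: side h2 hk hk'.
Qed.

Lemma escape_outside e y : e \in escapes ->
  0 < edge e.1.1 e.1.2 y -> 0 < edge e.2.1 e.2.2 y -> ~ spectre R y.
Proof.
move=> eE h1 h2 [By|[_]]; first exact: (escape_boundary eE h1 h2).
have edge_end i j : edge i j (vert i) = 0 /\ edge i j (vert j) = 0.
  by rewrite /edge /signed_area2; split; ring.
have z1 : edge e.1.1 e.1.2 (vert e.1.2) = 0 by case: (edge_end e.1.1 e.1.2).
have z2 : edge e.2.1 e.2.2 (vert e.1.2) = 0.
  have : all (fun e => (e.1.2 == e.2.1) || (e.1.2 == e.2.2)) escapes by [].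
  by move=> /allP/(_ e eE)/orP[] /eqP ->; case: (edge_end e.2.1 e.2.2).
(* The vertex [e.1.2] lies on both bounding lines, so along the ray that leads away from it through
   [y] both edge functions are multiplied by [1 + a] and stay positive. *)
apply: (@ray_unbounded _ _ _ (y - vert e.1.2)).
  by apply: contraTneq h1 => /subr0_eq ->; rewrite z1 ltxx.
move=> a a0.
have -> : y + a *: (y - vert e.1.2) = (1 + a) *: y + (- a) *: vert e.1.2.
  by rewrite scalerBr scalerDl scale1r scaleNr addrA.
apply: (escape_boundary eE); rewrite edge_affine ?addrK // ?z1 ?z2 mulr0 addr0.
  by rewrite mulr_gt0 // ltr_pwDl.
by rewrite mulr_gt0 // ltr_pwDl.
Qed.

(** * Generic points *)

Definition sides : seq (nat * nat) :=
  flatten [seq [:: (s.1.1, s.1.2); (s.1.2, s.2); (s.2, s.1.1)] | s <- triangles].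

(** Whole lines are avoided, not only segments: this makes the inequalities of [in_triangle] strict,
    whichever triangle contains the point. *)
Definition generic t x := forall s, s \in sides -> edge s.1 s.2 (unplace t x) != 0.

Lemma generic_winding t x : generic t x -> (place t @` spectre R) x ->
  winding x (map (place t) vertices) < 0.
Proof.
move=> gx [y Sy yx].
have [[e eE [h1 h2]]|[s st [h1 h2 h3]]] := escape_or_triangle y.
  by case: (escape_outside eE h1 h2 Sy).
have sub a : a \in [:: (s.1.1, s.1.2); (s.1.2, s.2); (s.2, s.1.1)] -> a \in sides.
  by move=> h; apply/flattenP; exists [:: (s.1.1, s.1.2); (s.1.2, s.2); (s.2, s.1.1)];
    rewrite // map_f.
apply: (winding_lt0 st); rewrite lt_neqAle (gx (_, _)) ?sub ?inE ?eqxx ?orbT // -yx placeK //.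
Qed.

Lemma avoid_lines (l : seq ((R * R) * (R * R))) (U : set (R * R)) :
  {in l, forall e, e.1 != e.2} -> open U -> U !=set0 ->
  exists2 x, U x & {in l, forall e, signed_area2 e.1 e.2 x != 0}.
Proof.
elim: l U => [|e l IH] U ne oU [x0 Ux0]; first by exists x0.
pose V := U `&` [set x | signed_area2 e.1 e.2 x != 0].
have oV : open V.
  apply: openI => //.
  have -> : [set x | signed_area2 e.1 e.2 x != 0] =
      (signed_area2 e.1 e.2) @^-1` (~` [set 0]).
    by apply/seteqP; split=> x /= /eqP.
  apply: open_comp; last exact/closed_openC/closed_eq.
  move=> x _; apply: cvgB; apply: cvgMl_tmp; apply: cvgB;
    by [exact: cvg_fst | exact: cvg_snd | exact: cvg_cst].
have V0 : V !=set0.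
  have [xe|xe] := eqVneq (signed_area2 e.1 e.2 x0) 0; last by exists x0.
  (* A small move along the normal leaves the line without leaving [U]. *)
  pose n : R * R := (- (e.2.2 - e.1.2), e.2.1 - e.1.1).
  have nU : \forall a \near (0 : R), U (x0 + a *: n).
    have : (x0 + a *: n) @[a --> (0 : R)] --> x0 + 0 *: n.
      by apply: cvgD; [exact: cvg_cst | exact: cvgZr_tmp].
    by apply; rewrite scale0r addr0; exact: open_nbhs_nbhs.
  have [r /= r0 rU] := (nbhs_ballP _ _).1 nU.
  exists (x0 + (r / 2) *: n); split.
    by apply: rU; rewrite -ball_normE /= sub0r normrN gtr0_norm; lra.
  have e12 : e.1 != e.2 by apply: ne; rewrite inE eqxx.
  change (signed_area2 e.1 e.2 (x0 + (r / 2) *: n) != 0).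
  have -> : signed_area2 e.1 e.2 (x0 + (r / 2) *: n) = signed_area2 e.1 e.2 x0 +
      r / 2 * ((e.2.1 - e.1.1) ^+ 2 + (e.2.2 - e.1.2) ^+ 2).
    by rewrite /signed_area2 /n /= /GRing.scale /=; ring.
  rewrite xe add0r; apply: mulf_neq0; first by rewrite gt_eqF // divr_gt0.
  rewrite paddr_eq0 ?sqr_ge0 // !sqrf_eq0 !subr_eq0; apply: contra e12 => /andP[/eqP h1 /eqP h2].
  by apply/eqP/pair_eqP.
have [|x [Ux xe] xl] := IH V _ oV V0.
  by move=> f fl; apply: ne; rewrite inE fl orbT.
by exists x => // f; rewrite inE => /orP[/eqP -> //|]; exact: xl.
Qed.

Lemma generic_dense (l : seq ((R * R) * 'Z_12)) (U : set (R * R)) :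
  open U -> U !=set0 -> exists2 x, U x & {in l, forall t, generic t x}.
Proof.
move=> oU U0; pose line t (s : nat * nat) := (place t (vert s.1), place t (vert s.2)).
suff ne : {in [seq line t s | t <- l, s <- sides], forall e, e.1 != e.2}.
  have [x Ux xl] := avoid_lines ne oU U0.
  exists x => // t tl s ss; rewrite /edge -(signed_area2_place t) unplaceK.
  by apply: (xl (line t s)); apply/allpairsP; exists (t, s).
move=> _ /allpairsP[[t s] [_ /= ss ->]] /=; rewrite (can_eq (placeK t)).
have /flattenP[_ /mapP[r rt ->]] := ss.
have := triangle_area_gt0 rt; rewrite /triangle_area.
by rewrite !inE => h /or3P[] /eqP -> /=; apply: contraTneq h => ->;
  rewrite /signed_area2 -leNgt le_eqVlt; apply/orP; left; apply/eqP; ring.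
Qed.
End SpectreTile.

(** * The tiling *)

Section Tiling.
Variable R : realType.
Implicit Types (x : R * R) (t : (R * R) * 'Z_12).

Local Notation vertices := (mkseq (spectre_vertex R) 14).
Local Notation center := (center R).

Lemma tiles_part (V : zmodType) (e : 'Z_12 -> V) n X j p s0 i (t : V * 'Z_12) :
  (i < size (parts X j))%N -> let s := nth s0 (parts X j) i in
  t \in tiles e n s.1.2 s.2 (p + wdisp e (lpath n s.1.1)) -> t \in tiles e n.+1 X j p.
Proof.
move=> ij s ts; apply/flattenP; exists (tiles e n s.1.2 s.2 (p + wdisp e (lpath n s.1.1))) => //.
by rewrite -(nth_map s0 [::] (fun s => tiles e n s.1.2 s.2 (p + wdisp e (lpath n s.1.1)))) //
  mem_nth // size_map.
Qed.

Definition cluster (i : nat) : seq ((R * R) * 'Z_12) :=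
  tiles (dir R) (2 * i) Theta 3%:R (center i).

(** By [centerS], the path [wcenter] leads from the base point of the larger cluster exactly to
    [center i]. *)
Lemma sub_clusterS i : {subset cluster i <= cluster i.+1}.
Proof.
move=> t ti; rewrite /cluster mulnS.
have sT : (0 < size (parts Theta 3%:R))%N by vm_compute.
have sG : (2 < size (parts Gamma 5%:R))%N by vm_compute.
apply: (tiles_part (s0 := ([::], Theta, 0)) sT); rewrite -/Gamma_part; have [-> ->] := Gamma_partE.
apply: (tiles_part (s0 := ([::], Gamma, 0)) sG); rewrite -/Theta_part; have [-> ->] := Theta_partE.
by rewrite -addrA lpathS -wdisp_cat -lpath_cat -/wcenter centerS subrK.
Qed.

Lemma sub_cluster i j : (i <= j)%N -> {subset cluster i <= cluster j}.
Proof.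
move=> /subnKC <-; elim: (j - i)%N => [|k IH] t ti; first by rewrite addn0.
by rewrite addnS; exact/sub_clusterS/IH.
Qed.

Lemma cluster_winding B : exists i0 : nat, forall (i : nat) x, (i0 <= i)%N ->
  `|x.1| <= B -> `|x.2| <= B ->
  \sum_(t <- cluster i) winding x (map (place t) vertices) = -1.
Proof.
have [i0 hi0] := center_winding B; exists i0 => i x i0i x1 x2.
have crossing_inv p d : step_crossing x (p + dir R d) (dinv d) =
    - step_crossing x p d by rewrite /step_crossing dir_dinv addrK crossingN.
have := hi0 i x i0i x1 x2.
(* The number of levels is even, so the signs of the reflections cancel. *)
rewrite (chain_tiles (@dir_dinv R) crossing_inv) exprM sqrrN !expr1n mulr1z => <-.
by apply: eq_bigr => -[q k] _; rewrite winding_place.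
Qed.

Definition spectre_tiling : set (set (R * R)) :=
  [set place t @` spectre R | t in [set t | exists i, t \in cluster i]].

Lemma spectre_tiling_cover : cover spectre_tiling id = setT.
Proof.
apply/seteqP; split=> // x _.
have [i0 /(_ i0 x (leqnn _))] := cluster_winding (Num.max `|x.1| `|x.2|).
rewrite !le_max !lexx orbT => /(_ isT isT) sum1.
have [t ti wt] : exists2 t, t \in cluster i0 & winding x (map (place t) vertices) != 0.
  apply: contrapT => nt; move: sum1; rewrite big_seq big1 // => t ti.
  by apply/eqP; apply: contrapT => /negP wt; apply: nt; exists t.
exists (place t @` spectre R); first by exists t => //; exists i0.
exact: place_closed_polygon.
Qed.

Lemma sum_two_negative (I : eqType) (s : seq I) (w : I -> int) a b :
  (forall i, w i <= 0) -> a \in s -> b \in s -> a != b -> w a < 0 -> w b < 0 ->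
  \sum_(i <- s) w i < -1.
Proof.
move=> w0 sa sb ab wa wb; rewrite (big_rem a) //= (big_rem b) /=; last first.
  by move: sb; rewrite (perm_mem (perm_to_rem sa)) inE eq_sym (negbTE ab).
have : \sum_(i <- rem b (rem a s)) w i <= 0 by exact: sumr_le0.
move: (\sum_(i <- _) w i) (w a) (w b) wa wb => S x y; lia.
Qed.

Lemma spectre_tiling_trivIset : trivIset spectre_tiling (@interior (R * R)%type).
Proof.
move=> _ _ [t1 [i1 t1i] <-] [t2 [i2 t2i] <-] U0.
have oU : open ((place t1 @` spectre R)° `&` (place t2 @` spectre R)°).
  by apply: openI; exact: open_interior.
have [x [/interior_subset x1 /interior_subset x2] gx] := generic_dense [:: t1; t2] oU U0.
have [-> //|t12] := eqVneq t1 t2.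
have w1 : winding x (map (place t1) vertices) < 0.
  by apply: generic_winding x1; apply: gx; rewrite inE eqxx.
have w2 : winding x (map (place t2) vertices) < 0.
  by apply: generic_winding x2; apply: gx; rewrite !inE eqxx orbT.
have [i0 hi0] := cluster_winding (Num.max `|x.1| `|x.2|).
(* A cluster that contains both tiles and already winds once around [x]. *)
pose i := (i0 + (i1 + i2))%N.
have ti1 : t1 \in cluster i by apply: sub_cluster t1i; lia.
have ti2 : t2 \in cluster i by apply: sub_cluster t2i; lia.
have := sum_two_negative (fun t => winding_le0 x t) ti1 ti2 t12 w1 w2.
by rewrite hi0 ?leq_addr ?le_max ?lexx ?orbT // ltxx.
Qed.

End Tiling.

Theorem corollary65 (R : realType) :
  exists T : set (set (R * R)), tiling_without_reflections (spectre R) T.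
Proof.
exists (@spectre_tiling R); split; last exact: spectre_tiling_trivIset.
  move=> _ [t _ <-]; exists (place t); split=> //.
    exact: place_isometry.
  exact: place_orientation.
exact: spectre_tiling_cover.
Qed.
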